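(* Given a regular internal solitary wave $U^c(\xi,y)=(\rho^c,u^c,v^c,p^c)^{T}$ of speed $c$ with stream function $\psi^c$, the associated Euler eigenvalue problem with spectral parameter $\kappa\in\mathbb{C}$, $$\begin{aligned} -\kappa\rho &= (u^c-c)\rho_\xi + v^c\rho_y + u\rho^c_\xi + v\rho^c_y,\\ -\rho^c\kappa u &= \rho^c\big((u^c-c)u_\xi+uu^c_\xi+v^cu_y+vu^c_y\big)+\rho\big((u^c-c)u^c_\xi+v^cu^c_y\big)+p_\xi,\\ -\rho^c\kappa v &= \rho^c\big((u^c-c)v_\xi+uv^c_\xi+v^cv_y+vv^c_y\big)+\rho\big((u^c-c)v^c_\xi+v^cv^c_y\big)+p_y+g\rho,\\ 0&=u_\xi+v_y, \end{aligned}$$ for $(\rho,u,v,p)(\xi,y)$, $\xi\in\mathbb{R}$, $0<y<1$, can formally be written as the abstract ordinary differential equation $$W'(\xi)=\mathbb{A}(\xi;\kappa)W(\xi)$$ in the space $(\mathcal{W},\langle\cdot,\cdot\rangle)$, $\mathcal{W}=(L^2(0,1))^4$, where $$W(\xi)=(\rho(\xi,\cdot),\psi(\xi,\cdot),\psi_\xi(\xi,\cdot),\psi_{\xi\xi}(\xi,\cdot))^{T}\in\mathcal{W},$$ $\psi$ is the stream function of $(u,v)$ (that is, $\psi_y=u$, $\psi_\xi=-v$, $\psi(\xi,0)=\psi(\xi,1)=0$), and $$\mathbb{A}(\xi;\kappa)=\begin{pmatrix}R_1&R_2&R_3&0\\0&0&1&0\\0&0&0&1\\S_1&S_2&S_3&S_4\end{pmatrix},\qquad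 R_j=\frac{\tilde R_j}{\psi^c_y-c},\quad S_k=\frac{\tilde S_k}{(\psi^c_y-c)\rho^c}$$ for $j\in\{1,2,3\}$ and $k\in\{1,2,3,4\}$, with $$\begin{aligned} \tilde R_1&=-\kappa+\psi^c_\xi\partial_y,\qquad \tilde R_2=-\rho^c_\xi\partial_y,\qquad \tilde R_3=\rho^c_y,\\ \tilde S_1&=\big[-(\psi^c_y-c)(\psi^c_{\xi yy}+\psi^c_{\xi\xi\xi})+\psi^c_\xi(\psi^c_{yyy}+\psi^c_{\xi\xi y})-(\psi^c_y-c)^{-1}(g\kappa+\kappa\psi^c_\xi\psi^c_{\xi y})+\kappa\psi^c_{\xi\xi}\big]\\ &\quad+\big[-(\psi^c_y-c)\psi^c_{\xi y}+\psi^c_\xi\psi^c_{yy}-\psi^c_\xi\psi^c_{\xi\xi}+(\psi^c_y-c)^{-1}(g\psi^c_\xi+(\psi^c_\xi)^2\psi^c_{\xi y})\big]\partial_y,\\ \tilde S_2&=\big[-\rho^c_y\psi^c_{\xi y}-\rho^c\psi^c_{\xi yy}-\rho^c\psi^c_{\xi\xi\xi}-(\psi^c_y-c)^{-1}(g\rho^c_\xi+\rho^c_\xi\psi^c_\xi\psi^c_{\xi y})-\kappa\rho^c_y\big]\partial_y\\ &\quad+\big[\rho^c_y\psi^c_\xi-\kappa\rho^c\big]\partial_{yy}+\big[\rho^c\psi^c_\xi\big]\partial_{yyy},\\ \tilde S_3&=\big[\rho^c_y\psi^c_{yy}+\rho^c_\xi\psi^c_{\xi y}+\rho^c\psi^c_{yyy}+\rho^c\psi^c_{\xi\xi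 y}-\rho^c_y\psi^c_{\xi\xi}+(\psi^c_y-c)^{-1}(g\rho^c_y+\rho^c_y\psi^c_\xi\psi^c_{\xi y})-\kappa\rho^c_\xi\big]\\ &\quad+\big[-\rho^c_y(\psi^c_y-c)+\rho^c_\xi\psi^c_\xi\big]\partial_y+\big[-\rho^c(\psi^c_y-c)\big]\partial_{yy},\\ \tilde S_4&=\big[-\rho^c_\xi(\psi^c_y-c)-\kappa\rho^c\big]+\big[\rho^c\psi^c_\xi\big]\partial_y. \end{aligned}$$
   Context: Let $g$ be the constant acceleration due to gravity and let $\bar\rho$ be a differentiable density stratification with $\bar\rho(y)>0$ and $\bar\rho'(y)<0$ for all $y\in[0,1]$. The channel is $\mathfrak{C}=\{(x,y):x\in\mathbb{R},\,0<y<1\}$. The Euler equations are $$\rho_t+u\rho_x+v\rho_y=0,\quad \rho(u_t+uu_x+vu_y)=-p_x,\quad \rho(v_t+uv_x+vv_y)=-p_y-g\rho,\quad u_x+v_y=0,$$ with boundary conditions $v(t,x,0)=v(t,x,1)=0$. The quiescent state is $\bar U(y)=(\bar\rho(y),0,0,-g\int_0^y\bar\rho(\eta)\,d\eta)^{T}$. An internal solitary wave (ISW) of speed $c$ is a profile $U^c(\xi,y)=(\rho^c,u^c,v^c,p^c)^{T}$ such that $U(t,x,y)=U^c(x-ct,y)$ is a classical solution of the Euler equations with these boundary conditions and $U^c(\xi,y)\to\bar U(y)$ uniformly in $y$ as $|\xi|\to\infty$. Its stream function $\psi^c$ is given by $\psi^c_\xi=-v^c$, $\psi^c_y=u^c$,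 $\psi^c(\xi,0)=\psi^c(\xi,1)=0$. The ISW is called regular if: (A1) $U^c\in C^3(\mathfrak{C})$; (A2) there are constants $C_1,C_2>0$ with $|\partial_\xi^\alpha\partial_y^\beta(U^c(\xi,y)-\bar U(y))|\le C_1e^{-C_2|\xi|}$ for all $\alpha,\beta\in\{0,1,2,3\}$ with $0\le\alpha+\beta\le3$; (A3) each level set $\{(\xi,y):\rho^c(\xi,y)=\varrho\}$, $\varrho\in\operatorname{range}\bar\rho$, can be written as the graph $y=Y^\varrho(\xi)$ of some differentiable function $Y^\varrho:\mathbb{R}\to[0,1]$. The eigenvalue problem arises by inserting the perturbation $e^{\kappa t}(\rho,u,v,p)(\xi,y)$ into the linearization of the Euler equations about $U^c$. The space $\mathcal{W}$ carries the scalar product $\langle U,V\rangle=\int_0^1(-\bar\rho')\big(\tfrac{U_1V_1}{(\bar\rho')^2}+U_2V_2+U_3V_3+U_4V_4\big)\,dy$. The reformulation is purely formal: questions of regularity, domains and ranges of operators are systematically disregarded, and no rigorous interpretation of the infinite-dimensional system is claimed. *)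

(* Defs.v *)
(* Calculus is done with Coquelicot over the reals of Stdlib; MathComp-Analysis
   supplies the Lebesgue measure and integral on the same type R. *)
From mathcomp Require Import all_boot all_order all_algebra.
From mathcomp Require Import all_classical all_reals all_analysis.
From mathcomp Require Import Rstruct Rstruct_topology.
From Stdlib Require Import Reals.
From Coquelicot Require Import Coquelicot.

Set Implicit Arguments.
Unset Strict Implicit.
Unset Printing Implicit Defensive.

(* All conditions "in the channel" below are imposed on this open strip only;
   values of the (total) functions outside its closure are never used. *)
Definition channel (xi y : R) : Prop := (0 < y < 1)%R.

Definition cont_closed_channel (f : R -> R -> R) : Prop :=
  continuous_on (fun z : R * R => (0 <= snd z <= 1)%R)
                (fun z : R * R => f (fst z) (snd z)).

Definition Cn (n : nat) (f : R -> R -> R) : Prop :=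
  forall xi y, channel xi y -> ex_diff_n f n xi y.

Definition re2 (f : R -> R -> C) : R -> R -> R := fun xi y => Re (f xi y).
Definition im2 (f : R -> R -> C) : R -> R -> R := fun xi y => Im (f xi y).

Definition CnC (n : nat) (f : R -> R -> C) : Prop :=
  Cn n (re2 f) /\ Cn n (im2 f).

(* pd a b f is the a-th xi-derivative of the b-th y-derivative of f. *)
Notation pd := partial_derive.

Definition dC (a b : nat) (f : R -> R -> C) (xi y : R) : C :=
  (pd a b (re2 f) xi y, pd a b (im2 f) xi y).

Definition dyC (k : nat) (w : R -> C) (y : R) : C :=
  (Derive_n (fun t => Re (w t)) k y, Derive_n (fun t => Im (w t)) k y).

Record state := State {
  s_rho : R -> R -> R;
  s_u : R -> R -> R;
  s_v : R -> R -> R;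
  s_p : R -> R -> R }.

(* The derivative at y is taken relative to [0,1], i.e. one-sided at 0 and 1. *)
Definition stratification (rb : R -> R) : Prop :=
  forall y : R, (0 <= y <= 1)%R ->
    (0 < rb y)%R /\
    exists l : R, (l < 0)%R /\
      filterlim (fun z : R => ((rb z - rb y) / (z - y))%R)
        (within (fun z : R => (0 <= z <= 1)%R) (locally' y)) (locally l).

Definition quiescent (g : R) (rb : R -> R) : state :=
  State (fun _ y => rb y) (fun _ _ => 0%R) (fun _ _ => 0%R)
        (fun _ y => (- g * RInt rb 0 y)%R).

Definition pd_t (f : R -> R -> R -> R) (t x y : R) : R :=
  Derive (fun s => f s x y) t.
Definition pd_x (f : R -> R -> R -> R) (t x y : R) : R :=
  Derive (fun s => f t s y) x.
Definition pd_y (f : R -> R -> R -> R) (t x y : R) : R :=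
  Derive (fun s => f t x s) y.

Definition uncurry3 (f : R -> R -> R -> R) (q : R * R * R) : R :=
  f (fst (fst q)) (snd (fst q)) (snd q).

Definition classical3 (f : R -> R -> R -> R) : Prop :=
  continuous_on (fun q : R * R * R => (0 <= snd q <= 1)%R) (uncurry3 f) /\
  forall t x y : R, channel x y ->
    ex_derive (fun s => f s x y) t /\
    ex_derive (fun s => f t s y) x /\
    ex_derive (fun s => f t x s) y /\
    continuous (uncurry3 (pd_t f)) (t, x, y) /\
    continuous (uncurry3 (pd_x f)) (t, x, y) /\
    continuous (uncurry3 (pd_y f)) (t, x, y).

Definition euler_solution (g : R) (rho u v p : R -> R -> R -> R) : Prop :=
  classical3 rho /\ classical3 u /\ classical3 v /\ classical3 p /\
  (forall t x y : R, channel x y ->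
    (pd_t rho t x y + u t x y * pd_x rho t x y + v t x y * pd_y rho t x y = 0
     /\ rho t x y * (pd_t u t x y + u t x y * pd_x u t x y
                     + v t x y * pd_y u t x y)
        = - pd_x p t x y
     /\ rho t x y * (pd_t v t x y + u t x y * pd_x v t x y
                     + v t x y * pd_y v t x y)
        = - pd_y p t x y - g * rho t x y
     /\ pd_x u t x y + pd_y v t x y = 0)%R) /\
  (forall t x : R, v t x 0%R = 0%R /\ v t x 1%R = 0%R).

Definition travelling (c : R) (f : R -> R -> R) : R -> R -> R -> R :=
  fun t x y => f (x - c * t)%R y.

Definition unif_limit (f h : R -> R -> R) : Prop :=
  forall eps : R, (0 < eps)%R -> exists M : R, forall xi y : R,
    (M < Rabs xi)%R -> (0 <= y <= 1)%R -> (Rabs (f xi y - h xi y) < eps)%R.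

Definition solitary_wave (g : R) (rb : R -> R) (c : R) (U : state) : Prop :=
  euler_solution g (travelling c (s_rho U)) (travelling c (s_u U))
                   (travelling c (s_v U)) (travelling c (s_p U)) /\
  unif_limit (s_rho U) (s_rho (quiescent g rb)) /\
  unif_limit (s_u U) (s_u (quiescent g rb)) /\
  unif_limit (s_v U) (s_v (quiescent g rb)) /\
  unif_limit (s_p U) (s_p (quiescent g rb)).

(* Derivatives are total operators, so the existence of those being bounded is
   required explicitly. *)
Definition exp_decay (K1 K2 : R) (f : R -> R -> R) : Prop :=
  Cn 3 f /\
  forall a b : nat, leq (addn a b) 3 -> forall xi y : R, channel xi y ->
    (Rabs (pd a b f xi y) <= K1 * exp (- K2 * Rabs xi))%R.

Definition diff2 (f h : R -> R -> R) : R -> R -> R :=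
  fun xi y => (f xi y - h xi y)%R.

Definition regular_wave (g : R) (rb : R -> R) (U : state) : Prop :=
  (Cn 3 (s_rho U) /\ Cn 3 (s_u U) /\ Cn 3 (s_v U) /\ Cn 3 (s_p U)) /\
  (exists K1 K2 : R, (0 < K1)%R /\ (0 < K2)%R /\
     exp_decay K1 K2 (diff2 (s_rho U) (s_rho (quiescent g rb))) /\
     exp_decay K1 K2 (diff2 (s_u U) (s_u (quiescent g rb))) /\
     exp_decay K1 K2 (diff2 (s_v U) (s_v (quiescent g rb))) /\
     exp_decay K1 K2 (diff2 (s_p U) (s_p (quiescent g rb)))) /\
  (forall r : R, (exists y : R, (0 <= y <= 1)%R /\ r = rb y) ->
     exists Y : R -> R,
       (forall xi : R, (0 <= Y xi <= 1)%R /\ ex_derive Y xi) /\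
       (forall xi y : R, (0 <= y <= 1)%R ->
          (s_rho U xi y = r <-> y = Y xi))).

Definition stream (u v psi : R -> R -> R) : Prop :=
  cont_closed_channel psi /\
  (forall xi y : R, channel xi y ->
     is_derive (fun s => psi s y) xi (- v xi y)%R /\
     is_derive (fun t => psi xi t) y (u xi y)) /\
  (forall xi : R, psi xi 0%R = 0%R /\ psi xi 1%R = 0%R).

Definition streamC (u v psi : R -> R -> C) : Prop :=
  stream (re2 u) (re2 v) (re2 psi) /\ stream (im2 u) (im2 v) (im2 psi).

Local Open Scope C_scope.

Definition euler_eigenproblem (g c : R) (U : state) (kappa : C)
    (rho u v p : R -> R -> C) : Prop :=
  forall xi y : R, channel xi y ->
  let rc := s_rho U xi y in
  let uc := s_u U xi y in
  let vc := s_v U xi y in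
  let rc_xi := pd 1 0 (s_rho U) xi y in
  let rc_y := pd 0 1 (s_rho U) xi y in
  let uc_xi := pd 1 0 (s_u U) xi y in
  let uc_y := pd 0 1 (s_u U) xi y in
  let vc_xi := pd 1 0 (s_v U) xi y in
  let vc_y := pd 0 1 (s_v U) xi y in
  let r := rho xi y in
  let u0 := u xi y in
  let v0 := v xi y in
  - kappa * r
    = (uc - c) * dC 1 0 rho xi y + vc * dC 0 1 rho xi y
      + u0 * rc_xi + v0 * rc_y
  /\
  - rc * kappa * u0
    = rc * ((uc - c) * dC 1 0 u xi y + u0 * uc_xi
            + vc * dC 0 1 u xi y + v0 * uc_y)
      + r * ((uc - c) * uc_xi + vc * uc_y)
      + dC 1 0 p xi y
  /\
  - rc * kappa * v0
    = rc * ((uc - c) * dC 1 0 v xi y + u0 * vc_xi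
            + vc * dC 0 1 v xi y + v0 * vc_y)
      + r * ((uc - c) * vc_xi + vc * vc_y)
      + dC 0 1 p xi y + g * r
  /\
  RtoC 0 = dC 1 0 u xi y + dC 0 1 v xi y.

(* Functions of y in (0,1), four components; a representative of an element
   of W when inW holds, equality in W being equality a.e. *)
Record Wvec := mkW { w1 : R -> C; w2 : R -> C; w3 : R -> C; w4 : R -> C }.

Definition unit_interval : set (measurableTypeR R) :=
  fun y : R => (0 < y < 1)%R.

Definition in_L2 (w : R -> C) : Prop :=
  measurable_fun unit_interval
    (fun y : measurableTypeR R => Re (w y) : measurableTypeR R) /\
  measurable_fun unit_interval
    (fun y : measurableTypeR R => Im (w y) : measurableTypeR R) /\
  (\int[@lebesgue_measure R]_(y in unit_interval)
     (Cmod (w y) * Cmod (w y))%R%:E < +oo)%E.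

Definition inW (w : Wvec) : Prop :=
  in_L2 (w1 w) /\ in_L2 (w2 w) /\ in_L2 (w3 w) /\ in_L2 (w4 w).

(* Integrand of the scalar product <U, V>, sesquilinear since the components
   are complex. *)
Definition Wdensity (rb : R -> R) (U V : Wvec) (y : R) : C :=
  - Derive rb y *
    (w1 U y * Cconj (w1 V y) / (Derive rb y * Derive rb y)
     + w2 U y * Cconj (w2 V y)
     + w3 U y * Cconj (w3 V y)
     + w4 U y * Cconj (w4 V y)).

(* <U, U>; extended-real valued so that a divergent integral is not read as a
   finite number. *)
Definition Wsqnorm (rb : R -> R) (U : Wvec) : \bar R :=
  (\int[@lebesgue_measure R]_(y in unit_interval)
     (Re (Wdensity rb U U y))%:E)%E.

Definition Wmap2 (f : C -> C -> C) (U V : Wvec) : Wvec :=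
  mkW (fun y => f (w1 U y) (w1 V y)) (fun y => f (w2 U y) (w2 V y))
      (fun y => f (w3 U y) (w3 V y)) (fun y => f (w4 U y) (w4 V y)).

Definition Wsub : Wvec -> Wvec -> Wvec := Wmap2 Cminus.

Definition Wscale (a : R) (U : Wvec) : Wvec :=
  Wmap2 (fun x _ => a * x) U U.

(* W'(xi) = D in (W, <.,.>). *)
Definition is_Wderive (rb : R -> R) (W : R -> Wvec) (xi : R) (D : Wvec)
    : Prop :=
  inW D /\
  forall eps : R, (0 < eps)%R -> exists delta : R, (0 < delta)%R /\
    forall h : R, (0 < Rabs h < delta)%R ->
      (Wsqnorm rb
         (Wsub (Wscale (/ h)%R (Wsub (W (xi + h)%R) (W xi))) D) <= eps%:E)%E.

Definition Wdifferentiable (rb : R -> R) (W : R -> Wvec) : Prop :=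
  forall xi : R, inW (W xi) /\ exists D : Wvec, is_Wderive rb W xi D.

Definition Wof (rho psi : R -> R -> C) (xi : R) : Wvec :=
  mkW (rho xi) (psi xi) (dC 1 0 psi xi) (dC 2 0 psi xi).

(* In the coefficients, q is the background stream function psi^c and rc the
   background density rho^c. *)

Definition tR1 (q : R -> R -> R) (kappa : C) (xi : R) (w : R -> C) (y : R)
    : C :=
  - kappa * w y + pd 1 0 q xi y * dyC 1 w y.

Definition tR2 (rc : R -> R -> R) (xi : R) (w : R -> C) (y : R) : C :=
  - pd 1 0 rc xi y * dyC 1 w y.

Definition tR3 (rc : R -> R -> R) (xi : R) (w : R -> C) (y : R) : C :=
  pd 0 1 rc xi y * w y.

Definition tS1 (g c : R) (q : R -> R -> R) (kappa : C) (xi : R) (w : R -> C)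
    (y : R) : C :=
  (- (pd 0 1 q xi y - c) * (pd 1 2 q xi y + pd 3 0 q xi y)
   + pd 1 0 q xi y * (pd 0 3 q xi y + pd 2 1 q xi y)
   - / (pd 0 1 q xi y - c)
     * (g * kappa + kappa * pd 1 0 q xi y * pd 1 1 q xi y)
   + kappa * pd 2 0 q xi y) * w y
  + (- (pd 0 1 q xi y - c) * pd 1 1 q xi y
     + pd 1 0 q xi y * pd 0 2 q xi y
     - pd 1 0 q xi y * pd 2 0 q xi y
     + / (pd 0 1 q xi y - c)
       * (g * pd 1 0 q xi y + (pd 1 0 q xi y * pd 1 0 q xi y) * pd 1 1 q xi y))
    * dyC 1 w y.

Definition tS2 (g c : R) (rc q : R -> R -> R) (kappa : C) (xi : R)
    (w : R -> C) (y : R) : C :=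
  (- pd 0 1 rc xi y * pd 1 1 q xi y
   - rc xi y * pd 1 2 q xi y
   - rc xi y * pd 3 0 q xi y
   - / (pd 0 1 q xi y - c)
     * (g * pd 1 0 rc xi y + pd 1 0 rc xi y * pd 1 0 q xi y * pd 1 1 q xi y)
   - kappa * pd 0 1 rc xi y) * dyC 1 w y
  + (pd 0 1 rc xi y * pd 1 0 q xi y - kappa * rc xi y) * dyC 2 w y
  + (rc xi y * pd 1 0 q xi y) * dyC 3 w y.

Definition tS3 (g c : R) (rc q : R -> R -> R) (kappa : C) (xi : R)
    (w : R -> C) (y : R) : C :=
  (pd 0 1 rc xi y * pd 0 2 q xi y
   + pd 1 0 rc xi y * pd 1 1 q xi y
   + rc xi y * pd 0 3 q xi y
   + rc xi y * pd 2 1 q xi y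
   - pd 0 1 rc xi y * pd 2 0 q xi y
   + / (pd 0 1 q xi y - c)
     * (g * pd 0 1 rc xi y + pd 0 1 rc xi y * pd 1 0 q xi y * pd 1 1 q xi y)
   - kappa * pd 1 0 rc xi y) * w y
  + (- pd 0 1 rc xi y * (pd 0 1 q xi y - c)
     + pd 1 0 rc xi y * pd 1 0 q xi y) * dyC 1 w y
  + (- rc xi y * (pd 0 1 q xi y - c)) * dyC 2 w y.

Definition tS4 (c : R) (rc q : R -> R -> R) (kappa : C) (xi : R)
    (w : R -> C) (y : R) : C :=
  (- pd 1 0 rc xi y * (pd 0 1 q xi y - c) - kappa * rc xi y) * w y
  + (rc xi y * pd 1 0 q xi y) * dyC 1 w y.

(* The first and fourth rows are divided by psi^c_y - c and by
   (psi^c_y - c) rho^c respectively. *)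
Definition Aop (g c : R) (rc q : R -> R -> R) (kappa : C) (xi : R) (W : Wvec)
    : Wvec :=
  mkW
    (fun y => tR1 q kappa xi (w1 W) y / (pd 0 1 q xi y - c)
              + tR2 rc xi (w2 W) y / (pd 0 1 q xi y - c)
              + tR3 rc xi (w3 W) y / (pd 0 1 q xi y - c))
    (w3 W)
    (w4 W)
    (fun y => tS1 g c q kappa xi (w1 W) y / ((pd 0 1 q xi y - c) * rc xi y)
              + tS2 g c rc q kappa xi (w2 W) y
                / ((pd 0 1 q xi y - c) * rc xi y)
              + tS3 g c rc q kappa xi (w3 W) y
                / ((pd 0 1 q xi y - c) * rc xi y)
              + tS4 c rc q kappa xi (w4 W) y
                / ((pd 0 1 q xi y - c) * rc xi y)).

Definition solves_ODE (rb : R -> R) (A : R -> Wvec -> Wvec) (W : R -> Wvec)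
    : Prop :=
  forall xi : R, is_Wderive rb W xi (A xi (W xi)).

(* Main.v *)
(* Writing (u, v) and (u^c, v^c) through their stream functions makes the
   continuity equation void. The mass equation can be solved for rho_xi, which
   is the first row of A. By the Poincare lemma on the strip, a pressure exists
   if and only if the curl of the two momentum equations vanishes; once rho_xi
   is eliminated by the first row, this curl condition has leading term
   (psi^c_y - c) rho^c psi_xixixi and is the fourth row. Dividing by rho^c is
   legitimate because rho^c is transported along the streamlines of
   (u^c - c, v^c), which extend to xi = +oo, where rho^c approaches the positive
   stratification. Finally, the derivative of W in the weighted L^2 space agrees
   almost everywhere with the pointwise derivative, by Fatou's lemma applied to
   the difference quotients, and everywhere if both sides are continuous. *)

Require Import Defs.
From Stdlib Require Import Reals Lra Lia.
From Coquelicot Require Import Coquelicot.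
From mathcomp Require all_boot all_order all_algebra.
From mathcomp Require all_classical all_reals all_analysis measurable_realfun.
From mathcomp Require Rstruct Rstruct_topology.

Open Scope R_scope.

(** * Calculus on the channel *)

(** The pressure is not a component of W, so the equivalence relates the existence of some pressure
    to the equation for W. The curl of the momentum equations matches the fourth row only modulo the
    first, hence the first row has to be secured before the fourth is discussed; the second and
    third rows merely repeat how W is built. Positivity of the density needs streamlines that reach
    infinity inside the channel, although smoothness is known in the open strip only. Level curves
    of a function monotone in y replace the integration of a flow. The condition that u^c - c has no
    zero serves twice here: together with the wall conditions it forces c to be nonzero, and it
    yields the monotonicity. A derivative in W is determined only up to null sets. Differentiability
    of W provides some derivative without a formula, and the work lies in replacing it by the
    explicit one. This requires a measurable weight, hence a continuous derivative of the
    stratification, which is inherited from the smoothness of the wave. *)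

Lemma channel_locally (P : R -> R -> Prop) (xi y : R) :
  channel xi y -> (forall a b, channel a b -> P a b) -> locally_2d P xi y.
Proof.
  unfold channel; intros [h0 h1] H.
  assert (hd : 0 < Rmin y (1 - y)) by (apply Rmin_pos; lra).
  exists (mkposreal _ hd); simpl; intros a b _ hb; apply H; unfold channel.
  apply Rabs_def2 in hb.
  pose proof (Rmin_l y (1 - y)); pose proof (Rmin_r y (1 - y)); lra.
Qed.

Lemma interval_locally (P : R -> Prop) (y : R) :
  0 < y < 1 -> (forall t, 0 < t < 1 -> P t) -> locally y P.
Proof.
  intros hy H; destruct (channel_locally (fun _ b => P b) 0 y hy) as [d Hd];
    [intros a b; apply H|].
  exists d; intros t ht; apply (Hd 0 t); [|exact ht].
  replace (0 - 0) with 0 by ring; rewrite Rabs_R0; apply cond_pos.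
Qed.

Lemma Cn_le (m n : nat) (f : R -> R -> R) : (m <= n)%nat -> Cn n f -> Cn m f.
Proof. intros h H xi y hy; apply ex_diff_n_m with n; auto. Qed.

Lemma Cn_ext (n : nat) (f h : R -> R -> R) :
  (forall xi y, channel xi y -> f xi y = h xi y) -> Cn n f -> Cn n h.
Proof.
  intros E H xi y hy; apply ex_diff_n_ext_loc with f; auto.
  now apply channel_locally.
Qed.

Lemma pd_ext (a b : nat) (f h : R -> R -> R) :
  (forall xi y, channel xi y -> f xi y = h xi y) ->
  forall xi y, channel xi y -> partial_derive a b f xi y = partial_derive a b h xi y.
Proof.
  intros E xi y hy; apply partial_derive_ext_loc; now apply channel_locally.
Qed.

Lemma Cn_pd (n a b : nat) (f : R -> R -> R) :
  (a + b <= n)%nat -> Cn n f -> Cn (n - (a + b)) (partial_derive a b f).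
Proof. intros h H xi y hy; apply ex_diff_n_deriv; auto. Qed.

Lemma Cn_continuous (n : nat) (f : R -> R -> R) (xi y : R) :
  Cn n f -> channel xi y -> continuity_2d_pt f xi y.
Proof. intros H hy; destruct n; apply (H xi y hy). Qed.

Lemma Cn_pd_continuous (n a b : nat) (f : R -> R -> R) (xi y : R) :
  (a + b <= n)%nat -> Cn n f -> channel xi y ->
  continuity_2d_pt (partial_derive a b f) xi y.
Proof. intros h H; apply (Cn_continuous (n - (a + b))); now apply Cn_pd. Qed.

Lemma Cn_is_derive_xi (n a b : nat) (f : R -> R -> R) (xi y : R) :
  (a + b < n)%nat -> Cn n f -> channel xi y ->
  is_derive (fun s => partial_derive a b f s y) xi (partial_derive (S a) b f xi y).
Proof.
  intros h H hy; apply Derive_correct.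
  apply (ex_diff_n_ex_deriv_inf_1 n); auto.
Qed.

(** [partial_derive] takes the xi-derivatives last, so a further y-derivative has to be commuted
    past them; this uses symmetry of mixed derivatives in a neighbourhood of the point. *)
Lemma Cn_is_derive_y (n a b : nat) (f : R -> R -> R) (xi y : R) :
  (a + b < n)%nat -> Cn n f -> channel xi y ->
  is_derive (fun t => partial_derive a b f xi t) y (partial_derive a (S b) f xi y).
Proof.
  intros h H hy; rewrite <- Derive_partial_derive.
  - apply Derive_correct, (ex_diff_n_ex_deriv_inf_2 n); auto.
  - apply channel_locally; auto; intros s t hst.
    apply ex_diff_n_m with n; [lia | auto].
Qed.

(** One continuous partial derivative controls the increments in xi near the point; in y a
    derivative at the point itself is enough. *)
Lemma differentiable_pt_lim_channel (f fx : R -> R -> R) (ly xi y : R) :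
  channel xi y ->
  (forall a b, channel a b -> is_derive (fun s => f s b) a (fx a b)) ->
  is_derive (fun t => f xi t) y ly ->
  continuity_2d_pt fx xi y ->
  differentiable_pt_lim f xi y (fx xi y) ly.
Proof.
  intros hy Hx Hy Cx; apply filterdiff_differentiable_pt_lim.
  eapply filterdiff_ext_lin.
  - apply (is_derive_filterdiff f xi y fx).
    + apply (proj1 (locally_2d_locally
        (fun a b => is_derive (fun s => f s b) a (fx a b)) xi y)).
      apply channel_locally; auto.
    + exact Hy.
    + now apply continuity_2d_pt_filterlim.
  - intros [a b]; reflexivity.
Qed.

(* A function with continuous partial derivatives is itself continuous, so
   the continuity clauses of [ex_diff_n] are redundant at positive order. *)
Lemma Cn_S (n : nat) (f fx fy : R -> R -> R) :
  (forall xi y, channel xi y -> is_derive (fun s => f s y) xi (fx xi y)) ->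
  (forall xi y, channel xi y -> is_derive (fun t => f xi t) y (fy xi y)) ->
  Cn n fx -> Cn n fy -> Cn (S n) f.
Proof.
  intros Hx Hy Cx Cy xi y hy.
  assert (E : forall a b, channel a b -> fx a b = Derive (fun s => f s b) a)
    by (intros; symmetry; apply is_derive_unique; auto).
  assert (F : forall a b, channel a b -> fy a b = Derive (fun t => f a t) b)
    by (intros; symmetry; apply is_derive_unique; auto).
  split; [|split; [|split; [|split]]].
  - apply differentiable_continuity_pt; exists (fx xi y), (fy xi y).
    apply differentiable_pt_lim_channel; auto; apply (Cn_continuous n); auto.
  - eexists; eauto.
  - eexists; eauto.
  - apply (Cn_ext n fx); auto.
  - apply (Cn_ext n fy); auto.
Qed.

Lemma Cn_const (n : nat) (k : R) : Cn n (fun _ _ => k).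
Proof.
  revert k; induction n as [|n IH]; intros k.
  - intros xi y _; split; auto; apply continuity_2d_pt_const.
  - apply (Cn_S n) with (fun _ _ => 0) (fun _ _ => 0); auto; intros;
      auto_derive; auto.
Qed.

Lemma Cn_plus (n : nat) (f h : R -> R -> R) :
  Cn n f -> Cn n h -> Cn n (fun xi y => f xi y + h xi y).
Proof.
  revert f h; induction n as [|n IH]; intros f h Hf Hh.
  - intros xi y hy; split; auto.
    apply continuity_2d_pt_plus; apply (Cn_continuous 0); auto.
  - apply (Cn_S n)
      with (fun xi y => partial_derive 1 0 f xi y + partial_derive 1 0 h xi y)
           (fun xi y => partial_derive 0 1 f xi y + partial_derive 0 1 h xi y).
    + intros xi y hy; apply @is_derive_plus;
        apply (Cn_is_derive_xi (S n) 0 0); auto; lia.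
    + intros xi y hy; apply @is_derive_plus;
        apply (Cn_is_derive_y (S n) 0 0); auto; lia.
    + apply IH; [apply (Cn_pd (S n) 1 0 f) in Hf | apply (Cn_pd (S n) 1 0 h) in Hh];
        try lia; now replace n with (S n - (1 + 0))%nat by lia.
    + apply IH; [apply (Cn_pd (S n) 0 1 f) in Hf | apply (Cn_pd (S n) 0 1 h) in Hh];
        try lia; now replace n with (S n - (0 + 1))%nat by lia.
Qed.

Lemma Cn_mult (n : nat) (f h : R -> R -> R) :
  Cn n f -> Cn n h -> Cn n (fun xi y => f xi y * h xi y).
Proof.
  revert f h; induction n as [|n IH]; intros f h Hf Hh.
  - intros xi y hy; split; auto.
    apply continuity_2d_pt_mult; apply (Cn_continuous 0); auto.
  - assert (S1 : forall k, Cn (S n) k ->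
      Cn n k /\ Cn n (partial_derive 1 0 k) /\ Cn n (partial_derive 0 1 k)).
    { intros k Hk; split; [apply (Cn_le n (S n)); auto|].
      pose proof (Cn_pd (S n) 1 0 k ltac:(lia) Hk) as Hx.
      pose proof (Cn_pd (S n) 0 1 k ltac:(lia) Hk) as Hy.
      now replace (S n - (1 + 0))%nat with n in Hx by lia;
        replace (S n - (0 + 1))%nat with n in Hy by lia. }
    destruct (S1 f Hf) as (F0 & F1 & F2), (S1 h Hh) as (H0 & H1 & H2).
    apply (Cn_S n)
      with (fun xi y => partial_derive 1 0 f xi y * h xi y
                        + f xi y * partial_derive 1 0 h xi y)
           (fun xi y => partial_derive 0 1 f xi y * h xi y
                        + f xi y * partial_derive 0 1 h xi y).
    + intros xi y hy; apply (is_derive_mult (fun s => f s y) (fun s => h s y));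
        [| | intros; apply Rmult_comm];
        apply (Cn_is_derive_xi (S n) 0 0); auto; lia.
    + intros xi y hy; apply (is_derive_mult (fun t => f xi t) (fun t => h xi t));
        [| | intros; apply Rmult_comm];
        apply (Cn_is_derive_y (S n) 0 0); auto; lia.
    + apply Cn_plus; apply IH; auto.
    + apply Cn_plus; apply IH; auto.
Qed.

Lemma Cn_opp (n : nat) (f : R -> R -> R) :
  Cn n f -> Cn n (fun xi y => - f xi y).
Proof.
  intros H; apply (Cn_ext n (fun xi y => (-1) * f xi y)).
  - intros; ring.
  - apply Cn_mult; auto; apply Cn_const.
Qed.

Lemma Cn_minus (n : nat) (f h : R -> R -> R) :
  Cn n f -> Cn n h -> Cn n (fun xi y => f xi y - h xi y).
Proof. intros Hf Hh; apply Cn_plus; auto; now apply Cn_opp. Qed.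

(** * Sections and potentials of closed forms on the strip *)

Lemma continuity_2d_pt_section_x (f : R -> R -> R) (xi y : R) :
  continuity_2d_pt f xi y -> continuous (fun s => f s y) xi.
Proof.
  intros H; apply continuity_pt_filterlim; intros eps heps.
  destruct (H (mkposreal eps heps)) as [d Hd]; exists d; split; [apply cond_pos|].
  intros s [_ hs]; apply Hd; [exact hs|].
  unfold Rminus; rewrite Rplus_opp_r, Rabs_R0; apply cond_pos.
Qed.

Lemma continuity_2d_pt_section_y (f : R -> R -> R) (xi y : R) :
  continuity_2d_pt f xi y -> continuous (fun t => f xi t) y.
Proof.
  intros H; apply continuity_pt_filterlim; intros eps heps.
  destruct (H (mkposreal eps heps)) as [d Hd]; exists d; split; [apply cond_pos|].
  intros s [_ hs]; apply Hd; [|exact hs].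
  unfold Rminus; rewrite Rplus_opp_r, Rabs_R0; apply cond_pos.
Qed.

(* Integrate first along the midline y = 1/2 and then vertically. *)
Lemma closed_form_exact (P Q : R -> R -> R) :
  Cn 1 P -> Cn 1 Q ->
  (forall xi y, channel xi y ->
     partial_derive 0 1 P xi y = partial_derive 1 0 Q xi y) ->
  exists p : R -> R -> R, forall xi y, channel xi y ->
    is_derive (fun s => p s y) xi (P xi y) /\
    is_derive (fun t => p xi t) y (Q xi y).
Proof.
  intros HP HQ E.
  set (m := / 2).
  assert (hm : forall s, channel s m) by (intros s; unfold channel, m; lra).
  assert (between : forall y t, 0 < y < 1 -> Rmin m y <= t <= Rmax m y -> 0 < t < 1).
  { intros y t hy; unfold m, Rmin, Rmax; destruct Rle_dec; lra. }
  assert (cQ : forall s t, channel s t -> continuous (fun t => Q s t) t)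
    by (intros; apply continuity_2d_pt_section_y, (Cn_continuous 1); auto).
  assert (cP : forall s, continuous (fun s => P s m) s)
    by (intros s; apply (continuity_2d_pt_section_x P), (Cn_continuous 1); auto).
  assert (iQ : forall s y, channel s y -> ex_RInt (fun t => Q s t) m y).
  { intros s y hy; apply (@ex_RInt_continuous R_CompleteNormedModule).
    intros t ht; apply cQ, (between y); auto. }
  assert (iP : forall s, ex_RInt (fun s => P s m) 0 s)
    by (intros s; apply (@ex_RInt_continuous R_CompleteNormedModule); auto).
  exists (fun s y => RInt (fun s => P s m) 0 s + RInt (fun t => Q s t) m y).
  intros xi y hy; split.
  (* Differentiation under the integral sign handles the vertical part; closedness turns its
     integrand into the y-derivative of P, which integrates to [P xi y - P xi m]. *)
  - replace (P xi y) with
      (P xi m + RInt (fun t => Derive (fun s => Q s t) xi) m y).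
    + apply @is_derive_plus.
      * apply (@is_derive_RInt R_NormedModule (fun s => P s m) _ 0 xi); auto.
        apply filter_forall; intros s; apply (@RInt_correct R_CompleteNormedModule), iP.
      * apply (is_derive_RInt_param Q m y xi).
        -- apply filter_forall; intros s t ht; eexists.
           apply (Cn_is_derive_xi 1 0 0 Q); auto.
           apply (between y); auto.
        -- intros t ht; apply (Cn_pd_continuous 1 1 0); auto.
           apply (between y); auto.
        -- apply filter_forall; intros s; apply iQ; exact hy.
    + rewrite (RInt_ext _ (Derive (fun t => P xi t))).
      * rewrite RInt_Derive.
        -- simpl; ring.
        -- intros t ht; eexists; apply (Cn_is_derive_y 1 0 0 P); auto.
           apply (between y); auto.
        -- intros t ht.
           apply (continuity_2d_pt_section_y (partial_derive 0 1 P)).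
           apply (Cn_pd_continuous 1); auto.
           apply (between y); auto.
      * intros t ht; symmetry; apply (E xi t).
        apply (between y); auto; lra.
  - replace (Q xi y) with (0 + Q xi y) by ring.
    apply @is_derive_plus; [apply @is_derive_const|].
    apply (@is_derive_RInt R_NormedModule (fun t => Q xi t) _ m y); auto.
    apply interval_locally; auto; intros t ht; apply (@RInt_correct R_CompleteNormedModule), iQ, ht.
Qed.

Lemma Cn_potential (n : nat) (p P Q : R -> R -> R) :
  Cn n P -> Cn n Q ->
  (forall xi y, channel xi y ->
     is_derive (fun s => p s y) xi (P xi y) /\
     is_derive (fun t => p xi t) y (Q xi y)) ->
  Cn (S n) p.
Proof. intros HP HQ H; apply (Cn_S n p P Q); auto; apply H. Qed.

(** * Complex-valued functions *)

Definition is_deriveC (f : R -> C) (x : R) (l : C) : Prop :=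
  is_derive (fun t => Re (f t)) x (Re l) /\ is_derive (fun t => Im (f t)) x (Im l).

Lemma is_deriveC_unique (f : R -> C) (x : R) (l l' : C) :
  is_deriveC f x l -> is_deriveC f x l' -> l = l'.
Proof.
  intros [H1 H2] [H3 H4].
  apply is_derive_unique in H1, H2, H3, H4.
  destruct l, l'; simpl in *; congruence.
Qed.

Lemma is_deriveC_ext_loc (f h : R -> C) (x : R) (l : C) :
  locally x (fun t => f t = h t) -> is_deriveC f x l -> is_deriveC h x l.
Proof.
  intros E [H1 H2]; split; eapply is_derive_ext_loc; eauto;
    revert E; apply filter_imp; now intros t ->.
Qed.

Lemma is_deriveC_const (k : C) (x : R) : is_deriveC (fun _ => k) x 0.
Proof. split; apply @is_derive_const. Qed.

Lemma is_deriveC_RtoC (f : R -> R) (x l : R) :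
  is_derive f x l -> is_deriveC (fun t => RtoC (f t)) x (RtoC l).
Proof. intros H; split; [exact H | exact (@is_derive_const R_AbsRing R_NormedModule 0 x)]. Qed.

Lemma is_deriveC_opp (f : R -> C) (x : R) (l : C) :
  is_deriveC f x l -> is_deriveC (fun t => - f t)%C x (- l)%C.
Proof. intros [H1 H2]; split; now apply @is_derive_opp. Qed.

Lemma is_deriveC_plus (f h : R -> C) (x : R) (l k : C) :
  is_deriveC f x l -> is_deriveC h x k ->
  is_deriveC (fun t => f t + h t)%C x (l + k)%C.
Proof. intros [H1 H2] [H3 H4]; split; now apply @is_derive_plus. Qed.

Lemma is_deriveC_minus (f h : R -> C) (x : R) (l k : C) :
  is_deriveC f x l -> is_deriveC h x k ->
  is_deriveC (fun t => f t - h t)%C x (l - k)%C.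
Proof. intros H K; apply is_deriveC_plus; auto; now apply is_deriveC_opp. Qed.

Lemma is_deriveC_mult (f h : R -> C) (x : R) (l k : C) :
  is_deriveC f x l -> is_deriveC h x k ->
  is_deriveC (fun t => f t * h t)%C x (l * h x + f x * k)%C.
Proof.
  intros [H1 H2] [H3 H4]; split; simpl.
  - replace (_ + _) with ((fst l * Re (h x) + Re (f x) * fst k)
      - (snd l * Im (h x) + Im (f x) * snd k)) by (unfold Re, Im; ring).
    apply @is_derive_minus; apply @is_derive_mult; auto; intros; apply Rmult_comm.
  - replace (_ + _) with ((fst l * Im (h x) + Re (f x) * snd k)
      + (snd l * Re (h x) + Im (f x) * fst k)) by (unfold Re, Im; ring).
    apply @is_derive_plus; apply @is_derive_mult; auto; intros; apply Rmult_comm.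
Qed.

(** * Continuity and smoothness of complex-valued functions *)

Definition continuousC (f : R -> C) (x : R) : Prop :=
  continuity_pt (fun t => Re (f t)) x /\ continuity_pt (fun t => Im (f t)) x.

Lemma continuousC_const (k : C) (x : R) : continuousC (fun _ => k) x.
Proof. split; now apply continuity_pt_const. Qed.

Lemma continuousC_RtoC (f : R -> R) (x : R) :
  continuity_pt f x -> continuousC (fun t => RtoC (f t)) x.
Proof. intros H; split; [exact H | now apply continuity_pt_const]. Qed.

Lemma continuousC_opp (f : R -> C) (x : R) :
  continuousC f x -> continuousC (fun t => - f t)%C x.
Proof. intros [H1 H2]; split; now apply continuity_pt_opp. Qed.

Lemma continuousC_plus (f h : R -> C) (x : R) :
  continuousC f x -> continuousC h x -> continuousC (fun t => f t + h t)%C x.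
Proof. intros [H1 H2] [H3 H4]; split; now apply continuity_pt_plus. Qed.

Lemma continuousC_minus (f h : R -> C) (x : R) :
  continuousC f x -> continuousC h x -> continuousC (fun t => f t - h t)%C x.
Proof. intros H K; apply continuousC_plus; auto; now apply continuousC_opp. Qed.

Lemma continuousC_mult (f h : R -> C) (x : R) :
  continuousC f x -> continuousC h x -> continuousC (fun t => f t * h t)%C x.
Proof.
  intros [H1 H2] [H3 H4]; split; simpl.
  - now apply continuity_pt_minus; apply continuity_pt_mult.
  - now apply continuity_pt_plus; apply continuity_pt_mult.
Qed.

Lemma continuousC_inv (f : R -> C) (x : R) :
  f x <> 0 -> continuousC f x -> continuousC (fun t => / f t)%C x.
Proof.
  intros hf [H1 H2].
  assert (hn : fst (f x) ^ 2 + snd (f x) ^ 2 <> 0).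
  { intros hz; apply hf; destruct (f x) as [a b]; simpl in hz.
    assert (a = 0) by nra; assert (b = 0) by nra; subst; reflexivity. }
  assert (Hd : continuity_pt (fun t => fst (f t) ^ 2 + snd (f t) ^ 2) x).
  { apply (continuity_pt_ext (fun t => Re (f t) * Re (f t) + Im (f t) * Im (f t))).
    - intros t; unfold Re, Im; ring.
    - now apply continuity_pt_plus; apply continuity_pt_mult. }
  split; simpl.
  - apply (continuity_pt_div (fun t => Re (f t))
             (fun t => fst (f t) ^ 2 + snd (f t) ^ 2)); auto.
  - apply (continuity_pt_div (fun t => - Im (f t))
             (fun t => fst (f t) ^ 2 + snd (f t) ^ 2)); auto.
    now apply continuity_pt_opp.
Qed.

Lemma CnC_const (n : nat) (k : C) : CnC n (fun _ _ => k).
Proof. split; [exact (Cn_const n (Re k)) | exact (Cn_const n (Im k))]. Qed.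

Lemma CnC_RtoC (n : nat) (f : R -> R -> R) :
  Cn n f -> CnC n (fun xi y => RtoC (f xi y)).
Proof. intros H; split; [exact H | exact (Cn_const n 0)]. Qed.

Lemma CnC_opp (n : nat) (f : R -> R -> C) :
  CnC n f -> CnC n (fun xi y => - f xi y)%C.
Proof. intros [H1 H2]; split; [apply (Cn_opp n _ H1) | apply (Cn_opp n _ H2)]. Qed.

Lemma CnC_plus (n : nat) (f h : R -> R -> C) :
  CnC n f -> CnC n h -> CnC n (fun xi y => f xi y + h xi y)%C.
Proof.
  intros [H1 H2] [H3 H4]; split;
    [apply (Cn_plus n _ _ H1 H3) | apply (Cn_plus n _ _ H2 H4)].
Qed.

Lemma CnC_minus (n : nat) (f h : R -> R -> C) :
  CnC n f -> CnC n h -> CnC n (fun xi y => f xi y - h xi y)%C.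
Proof. intros H K; apply CnC_plus; auto; now apply CnC_opp. Qed.

Lemma CnC_mult (n : nat) (f h : R -> R -> C) :
  CnC n f -> CnC n h -> CnC n (fun xi y => f xi y * h xi y)%C.
Proof.
  intros [H1 H2] [H3 H4]; split.
  - apply (Cn_minus n _ _ (Cn_mult n _ _ H1 H3) (Cn_mult n _ _ H2 H4)).
  - apply (Cn_plus n _ _ (Cn_mult n _ _ H1 H4) (Cn_mult n _ _ H2 H3)).
Qed.

Lemma CnC_le (m n : nat) (f : R -> R -> C) : (m <= n)%nat -> CnC n f -> CnC m f.
Proof. intros h [H1 H2]; split; now apply (Cn_le m n). Qed.

Lemma CnC_dC (n m a b : nat) (f : R -> R -> C) :
  (m + (a + b) <= n)%nat -> CnC n f -> CnC m (dC a b f).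
Proof.
  intros h [H1 H2]; split; apply (Cn_le m (n - (a + b))); try lia;
    apply (fun h => Cn_pd n a b _ h); auto; lia.
Qed.

Lemma CnC_is_derive_xi (n a b : nat) (f : R -> R -> C) (xi y : R) :
  (a + b < n)%nat -> CnC n f -> channel xi y ->
  is_deriveC (fun s => dC a b f s y) xi (dC (S a) b f xi y).
Proof.
  intros h [H1 H2] hy; split; simpl; apply (Cn_is_derive_xi n); auto.
Qed.

Lemma CnC_is_derive_y (n a b : nat) (f : R -> R -> C) (xi y : R) :
  (a + b < n)%nat -> CnC n f -> channel xi y ->
  is_deriveC (fun t => dC a b f xi t) y (dC a (S b) f xi y).
Proof.
  intros h [H1 H2] hy; split; simpl; apply (Cn_is_derive_y n); auto.
Qed.

Lemma dC_ext (a b : nat) (f h : R -> R -> C) :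
  (forall xi y, channel xi y -> f xi y = h xi y) ->
  forall xi y, channel xi y -> dC a b f xi y = dC a b h xi y.
Proof.
  intros E xi y hy; unfold dC.
  rewrite (pd_ext a b (re2 f) (re2 h)), (pd_ext a b (im2 f) (im2 h)); auto;
    intros s t hst; unfold re2, im2; now rewrite E.
Qed.

Lemma dC_continuous (n a b : nat) (f : R -> R -> C) (xi y : R) :
  (a + b <= n)%nat -> CnC n f -> channel xi y ->
  continuousC (fun t => dC a b f xi t) y.
Proof.
  intros h [H1 H2] hy; split; apply continuity_pt_filterlim;
    [apply (continuity_2d_pt_section_y (partial_derive a b (re2 f)))
    |apply (continuity_2d_pt_section_y (partial_derive a b (im2 f)))];
    apply (Cn_pd_continuous n); auto.
Qed.

(** The operator differentiates a component of W as a function of y alone; this identifies the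
    result with a mixed partial derivative. The induction compares the two functions near y, since
    agreement at one point says nothing about the next derivative. *)
Lemma dyC_dC (n k a b : nat) (f : R -> R -> C) (xi y : R) :
  (a + b + k <= n)%nat -> CnC n f -> channel xi y ->
  dyC k (dC a b f xi) y = dC a (b + k) f xi y.
Proof.
  revert y; induction k as [|k IH]; intros y h Hf hy.
  - unfold dyC; simpl; now rewrite Nat.add_0_r.
  - rewrite Nat.add_succ_r.
    apply (is_deriveC_unique (dC a (b + k) f xi) y).
    + apply (is_deriveC_ext_loc (dyC k (dC a b f xi))).
      * apply interval_locally; auto; intros t ht; apply IH; auto; lia.
      * assert (K : is_deriveC (dyC k (dC a b f xi)) y (dC a (S (b + k)) f xi y)).
        { apply (is_deriveC_ext_loc (dC a (b + k) f xi)).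
          - apply interval_locally; auto; intros t ht; symmetry; apply IH; auto; lia.
          - apply (CnC_is_derive_y n); auto; lia. }
        destruct K as [K1 K2]; split; simpl; apply Derive_correct;
          eexists; [exact K1 | exact K2].
    + apply (CnC_is_derive_y n); auto; lia.
Qed.

(** * Positivity of the background density *)

(** The differentiation half of the implicit function theorem. With continuity of Y given, a first
    use of the linearization of F bounds the increment of Y by [M] times that of x; a second use
    turns this bound into the derivative. *)
Lemma implicit_is_derive (F : R -> R -> R) (Y : R -> R) (x lx ly k : R) :
  differentiable_pt_lim F x (Y x) lx ly -> ly <> 0 -> continuity_pt Y x ->
  (forall s, F s (Y s) = k) -> is_derive Y x (- lx / ly).
Proof.
  intros HF hly HY HL; apply is_derive_Reals; intros eps heps.
  set (a := Rabs ly); assert (ha : 0 < a) by now apply Rabs_pos_lt.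
  set (M := (2 * Rabs lx + a) / a).
  pose proof (Rabs_pos lx) as hlx.
  assert (hM1 : 1 <= M).
  { unfold M; apply (Rmult_le_reg_r a); auto.
    unfold Rdiv; rewrite Rmult_assoc, Rinv_l; lra. }
  (* The first bound lets half of the slope [a] absorb the error, which gives
     [Rabs w <= M * Rabs h]; the second makes the remaining relative error at most [eps / 2]. *)
  assert (he : 0 < Rmin (a / 2) (eps * a / (2 * M))).
  { apply Rmin_pos; [lra|]; apply Rdiv_lt_0_compat; [apply Rmult_lt_0_compat|]; lra. }
  destruct (HF (mkposreal _ he)) as [d Hd]; simpl in Hd.
  destruct (HY d (cond_pos d)) as (d' & hd' & Hd').
  assert (hdd : 0 < Rmin d d') by (apply Rmin_pos; [apply cond_pos | exact hd']).
  exists (mkposreal _ hdd); simpl; intros h hh hlt.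
  pose proof (Rmin_l d d') as m1; pose proof (Rmin_r d d') as m2.
  set (w := Y (x + h) - Y x).
  assert (hw : Rabs w < d).
  { apply Hd'; split; [split; [exact I|]; lra|].
    simpl; unfold Rdist; replace (x + h - x) with h by ring; lra. }
  assert (B := Hd (x + h) (Y (x + h))).
  replace (x + h - x) with h in B by ring; fold w in B.
  specialize (B ltac:(lra) hw); rewrite !HL in B.
  replace (k - k - (lx * h + ly * w)) with (- (lx * h + ly * w)) in B by ring.
  rewrite Rabs_Ropp in B.
  set (e := Rmin (a / 2) (eps * a / (2 * M))) in *.
  assert (e1 : e <= a / 2) by apply Rmin_l.
  assert (e2 : e <= eps * a / (2 * M)) by apply Rmin_r.
  assert (hp : 0 < Rabs h) by now apply Rabs_pos_lt.
  pose proof (Rabs_pos w) as hwp.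
  assert (mx : Rmax (Rabs h) (Rabs w) <= Rabs h + Rabs w)
    by (apply Rmax_lub; lra).
  assert (T : a * Rabs w <= Rabs lx * Rabs h + Rabs (lx * h + ly * w)).
  { unfold a; rewrite <- !Rabs_mult.
    replace (ly * w) with ((lx * h + ly * w) + - (lx * h)) at 1 by ring.
    eapply Rle_trans; [apply Rabs_triang|]; rewrite Rabs_Ropp; lra. }
  assert (wM : Rabs w <= M * Rabs h).
  { unfold M; apply (Rmult_le_reg_l (a / 2)); [lra|].
    replace (a / 2 * ((2 * Rabs lx + a) / a * Rabs h))
      with ((Rabs lx + a / 2) * Rabs h) by (field; lra).
    assert (e * Rmax (Rabs h) (Rabs w) <= a / 2 * (Rabs h + Rabs w)).
    { apply Rmult_le_compat; try lra.
      apply Rle_trans with (Rabs h); [lra | apply Rmax_l]. }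
    lra. }
  assert (mM : Rmax (Rabs h) (Rabs w) <= M * Rabs h).
  { apply Rmax_lub; [|exact wM]; rewrite <- (Rmult_1_l (Rabs h)) at 1.
    apply Rmult_le_compat_r; lra. }
  replace (w / h - - lx / ly) with ((lx * h + ly * w) / (ly * h))
    by (field; split; assumption).
  unfold Rdiv; rewrite Rabs_mult, Rabs_inv, Rabs_mult; fold a.
  assert (pos : 0 < a * Rabs h) by now apply Rmult_lt_0_compat.
  apply (Rmult_lt_reg_r (a * Rabs h)); auto.
  rewrite Rmult_assoc, Rinv_l, Rmult_1_r by lra.
  apply Rle_lt_trans with (e * (M * Rabs h)).
  { eapply Rle_trans; [exact B|]; apply Rmult_le_compat_l; [lra | exact mM]. }
  apply Rle_lt_trans with (eps * a / (2 * M) * (M * Rabs h)).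
  { apply Rmult_le_compat_r; [nra | exact e2]. }
  replace (eps * a / (2 * M) * (M * Rabs h)) with (eps * (a * Rabs h) / 2)
    by (field; lra).
  assert (0 < eps * (a * Rabs h)) by now apply Rmult_lt_0_compat.
  lra.
Qed.

(* Assigning a wrong slope to the endpoints forces the point given by [MVT_gen]
   into the open interval. *)
Lemma mean_value_open (f df : R -> R) (a b : R) :
  a < b -> (forall x, a < x < b -> is_derive f x (df x)) ->
  (forall x, a <= x <= b -> continuity_pt f x) ->
  exists x, a < x < b /\ f b - f a = df x * (b - a).
Proof.
  intros hab Hd Hc.
  set (s := (f b - f a) / (b - a)).
  set (df' := fun x => if Rlt_dec a x then if Rlt_dec x b then df x else s + 1
                       else s + 1).
  destruct (MVT_gen f a b df') as (x & hx & E).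
  - rewrite Rmin_left, Rmax_right by lra; intros x hx; unfold df'.
    destruct Rlt_dec; [destruct Rlt_dec|]; try lra; auto.
  - rewrite Rmin_left, Rmax_right by lra; auto.
  - assert (F : f b - f a = s * (b - a)) by (unfold s; field; lra).
    unfold df' in E; destruct Rlt_dec; [destruct Rlt_dec|];
      [exists x; split; [lra | exact E] | |]; exfalso; nra.
Qed.

(** Composition with this retraction onto [0,1] turns continuity relative to the closed interval
    into continuity on the whole line, where the classical theorems apply, and discards the
    arbitrary values outside. *)
Definition clamp (t : R) : R := Rmax 0 (Rmin 1 t).

Lemma clamp_range (t : R) : 0 <= clamp t <= 1.
Proof.
  unfold clamp; split; [apply Rmax_l|].
  apply Rmax_lub; [lra | apply Rmin_l].
Qed.

Lemma clamp_id (t : R) : 0 <= t <= 1 -> clamp t = t.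
Proof. intros h; unfold clamp; rewrite Rmin_right, Rmax_right; lra. Qed.

Lemma clamp_lipschitz (s t : R) : Rabs (clamp s - clamp t) <= Rabs (s - t).
Proof.
  unfold clamp, Rmax, Rmin; repeat destruct Rle_dec;
    unfold Rabs; repeat destruct Rcase_abs; lra.
Qed.

Lemma clamp_continuous (t : R) : continuous clamp t.
Proof.
  intros P [d Hd]; exists d; intros s hs; apply Hd.
  apply Rle_lt_trans with (2 := hs), clamp_lipschitz.
Qed.

Lemma continuous_on_clamp (f : R -> R) :
  continuous_on (fun t => 0 <= t <= 1) f -> continuity (fun t => f (clamp t)).
Proof.
  intros Hf t; apply continuity_pt_filterlim.
  apply (filterlim_comp _ _ _ clamp f _
           (within (fun t => 0 <= t <= 1) (locally (clamp t)))).
  - intros P HP; change (locally t (fun s => P (clamp s))).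
    apply (filter_imp (fun s => 0 <= clamp s <= 1 -> P (clamp s))).
    + intros s hs; apply hs, clamp_range.
    + exact (clamp_continuous t _ HP).
  - apply Hf, clamp_range.
Qed.

Lemma cont_closed_channel_section (f : R -> R -> R) (xi : R) :
  cont_closed_channel f -> continuous_on (fun t => 0 <= t <= 1) (f xi).
Proof.
  intros Hf t ht P HP.
  destruct (Hf (xi, t) ht P HP) as [d Hd].
  exists d; intros s hs h; apply (Hd (xi, s)); [|exact h].
  split; [apply ball_center | exact hs].
Qed.

(* The streamlines of the flow (u - c, v) are the level curves of
   [y - psi / c]. They are graphs over the whole xi-axis, the density is
   constant along them, and at infinity it is close to the stratification. *)
Lemma transported_density_pos (rc q : R -> R -> R) (rb : R -> R) (c m : R) :
  Cn 1 rc -> Cn 1 q -> cont_closed_channel q ->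
  (forall xi, q xi 0 = 0 /\ q xi 1 = 0) ->
  (forall xi y, channel xi y -> partial_derive 0 1 q xi y - c <> 0) ->
  (forall xi y, channel xi y ->
     (partial_derive 0 1 q xi y - c) * partial_derive 1 0 rc xi y
     - partial_derive 1 0 q xi y * partial_derive 0 1 rc xi y = 0) ->
  unif_limit rc (fun _ y => rb y) ->
  0 < m -> (forall y, 0 <= y <= 1 -> m <= rb y) ->
  forall xi y, channel xi y -> 0 < rc xi y.
Proof.
  intros Hrc Hq Cq Bq hden Ht Hlim hm Hm.
  assert (Cc : forall xi, continuity (fun t => q xi (clamp t)))
    by (intros xi; apply continuous_on_clamp, cont_closed_channel_section, Cq).
  assert (dq : forall xi t, channel xi t ->
    is_derive (fun t => q xi (clamp t)) t (partial_derive 0 1 q xi t)).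
  { intros xi t ht; apply (is_derive_ext_loc (q xi)).
    - apply interval_locally; auto; intros s hs; rewrite clamp_id; [auto | lra].
    - apply (Cn_is_derive_y 1 0 0 q); auto. }
  (* Rolle: [q 0] vanishes at both walls, so its y-derivative has an interior zero, which for c = 0
     contradicts [hden]. *)
  assert (hc : c <> 0).
  { intros ->.
    destruct (mean_value_open (fun t => q 0 (clamp t)) (partial_derive 0 1 q 0) 0 1)
      as (t & ht & E); auto; try lra.
    { intros; apply Cc. }
    rewrite !clamp_id in E by lra; rewrite (proj1 (Bq 0)), (proj2 (Bq 0)) in E.
    apply (hden 0 t); auto; lra. }
  (* Dividing the stream function q - c y of the relative flow by -c makes it run from 0 at the
     bottom to 1 at the top. [F] serves for derivatives in xi, its clamped version [G] for arguments
     on closed vertical sections. *)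
  set (F := fun xi y => y - q xi y / c).
  set (G := fun xi y => clamp y - q xi (clamp y) / c).
  set (Fy := fun xi y => 1 - partial_derive 0 1 q xi y / c).
  assert (GF : forall xi y, 0 <= y <= 1 -> G xi y = F xi y)
    by (intros; unfold G, F; now rewrite clamp_id).
  assert (cG : forall xi, continuity (G xi)).
  { intros xi t; apply continuity_pt_minus.
    - apply continuity_pt_filterlim, clamp_continuous.
    - apply (continuity_pt_mult (fun t => q xi (clamp t)) (fun _ => / c)).
      + apply Cc.
      + now apply continuity_pt_const. }
  assert (dG : forall xi t, channel xi t -> is_derive (G xi) t (Fy xi t)).
  { intros xi t ht; unfold G, Fy, Rdiv; apply @is_derive_minus.
    - apply (is_derive_ext_loc (fun s => s)).
      + apply interval_locally; auto; intros s hs; rewrite clamp_id; [auto | lra].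
      + apply @is_derive_id.
    - replace (partial_derive 0 1 q xi t * / c)
        with (partial_derive 0 1 q xi t * / c + q xi (clamp t) * 0) by ring.
      apply (is_derive_mult (fun t => q xi (clamp t)) (fun _ => / c));
        [auto | apply @is_derive_const | intros; apply Rmult_comm]. }
  assert (G0 : forall xi, G xi 0 = 0).
  { intros xi; rewrite GF by lra; unfold F; rewrite (proj1 (Bq xi)); field; auto. }
  assert (G1 : forall xi, G xi 1 = 1).
  { intros xi; rewrite GF by lra; unfold F; rewrite (proj2 (Bq xi)); field; auto. }
  assert (Fy0 : forall xi t, channel xi t -> Fy xi t <> 0).
  { intros xi t ht hz; apply (hden xi t ht); unfold Fy in hz.
    replace (partial_derive 0 1 q xi t)
      with (c - c * (1 - partial_derive 0 1 q xi t / c)) by (field; auto).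
    rewrite hz; ring. }
  assert (cFy : forall xi t, channel xi t -> continuity_pt (Fy xi) t).
  { intros xi t ht; apply continuity_pt_minus; [now apply continuity_pt_const|].
    apply (continuity_pt_mult (partial_derive 0 1 q xi) (fun _ => / c)).
    - apply continuity_pt_filterlim, continuity_2d_pt_section_y.
      apply (Cn_pd_continuous 1); auto.
    - now apply continuity_pt_const. }
  (* The mean of [Fy] over a vertical section is 1, so it is positive somewhere; having no zero, it
     cannot change sign. *)
  assert (Fypos : forall xi t, channel xi t -> 0 < Fy xi t).
  { intros xi t ht; destruct (Rlt_le_dec 0 (Fy xi t)) as [|hle]; auto; exfalso.
    destruct (mean_value_open (G xi) (Fy xi) 0 1) as (s & hs & E); auto; try lra.
    { intros; apply cG. }
    rewrite G0, G1 in E.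
    assert (hs1 : Fy xi s = 1) by lra.
    assert (hneg : Fy xi t < 0) by (pose proof (Fy0 xi t ht); lra).
    unfold channel in ht; destruct (Rtotal_order t s) as [hlt | [-> | hgt]].
    - destruct (Ranalysis5.IVT_interv (Fy xi) t s) as (z & hz & E0); auto; try lra.
      + intros a ha; apply cFy; unfold channel; lra.
      + apply (Fy0 xi z); auto; unfold channel; lra.
    - lra.
    - destruct (Ranalysis5.IVT_interv (fun a => - Fy xi a) s t) as (z & hz & E0);
        auto; try lra.
      + intros a ha; apply continuity_pt_opp, cFy; unfold channel; lra.
      + apply (Fy0 xi z); [unfold channel|]; lra. }
  assert (Ginc : forall xi s t, 0 <= s -> s < t -> t <= 1 -> G xi s < G xi t).
  { intros xi s t h0 hst h1.
    destruct (mean_value_open (G xi) (Fy xi) s t) as (z & hz & E); auto.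
    - intros x hx; apply dG; unfold channel; lra.
    - intros; apply cG.
    - assert (0 < Fy xi z) by (apply Fypos; unfold channel; lra).
      assert (0 < Fy xi z * (t - s)) by (apply Rmult_lt_0_compat; lra).
      lra. }
  intros xi0 y0 hy0; unfold channel in hy0.
  set (k := G xi0 y0).
  assert (hk : 0 < k < 1).
  { rewrite <- (G0 xi0) at 1; rewrite <- (G1 xi0); split; apply Ginc; lra. }
  (* Every vertical section passes monotonically from 0 to 1 and so meets the level k exactly once,
     away from the walls: the streamline is defined for all xi and stays in the channel. *)
  assert (HY : forall xi, {y | 0 < y < 1 /\ G xi y = k}).
  { intros xi; destruct (IVT_gen (G xi) 0 1 k) as (y & hy & E); auto.
    - rewrite G0, G1, Rmin_left, Rmax_right; lra.
    - exists y; split; auto; rewrite Rmin_left, Rmax_right in hy by lra.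
      split; apply Rnot_le_lt; intros h.
      + assert (y = 0) by lra; subst y; rewrite G0 in E; lra.
      + assert (y = 1) by lra; subst y; rewrite G1 in E; lra. }
  set (Y := fun xi => proj1_sig (HY xi)).
  assert (Yr : forall xi, 0 < Y xi < 1) by (intros; apply (proj2_sig (HY xi))).
  assert (YG : forall xi, G xi (Y xi) = k) by (intros; apply (proj2_sig (HY xi))).
  assert (YF : forall xi, F xi (Y xi) = k).
  { intros xi; rewrite <- GF; auto; specialize (Yr xi); lra. }
  assert (dFx : forall xi y, channel xi y ->
    is_derive (fun s => F s y) xi (- (partial_derive 1 0 q xi y / c))).
  { intros xi y hy; unfold F, Rdiv.
    replace (- (partial_derive 1 0 q xi y * / c))
      with (0 - (partial_derive 1 0 q xi y * / c + q xi y * 0)) by ring.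
    apply @is_derive_minus; [apply @is_derive_const|].
    apply (is_derive_mult (fun s => q s y) (fun _ => / c));
      [apply (Cn_is_derive_xi 1 0 0 q); auto
      | apply @is_derive_const | intros; apply Rmult_comm]. }
  assert (Yc : forall xi, continuity_pt Y xi).
  { intros xi eps heps; specialize (Yr xi) as hy.
    (* Half the distances to the walls keep [Y xi - e] and [Y xi + e] inside the channel. At these
       heights F lies strictly below and above k; this persists for nearby s, and monotonicity traps
       [Y s] in between. *)
    set (e := Rmin (eps / 2) (Rmin (Y xi / 2) ((1 - Y xi) / 2))).
    assert (he : 0 < e) by (unfold e; repeat apply Rmin_pos; lra).
    assert (he1 : e <= eps / 2) by apply Rmin_l.
    assert (he2 : e <= Y xi / 2)
      by (eapply Rle_trans; [apply Rmin_r | apply Rmin_l]).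
    assert (he3 : e <= (1 - Y xi) / 2)
      by (eapply Rle_trans; [apply Rmin_r | apply Rmin_r]).
    assert (cF : forall y, channel xi y -> continuous (fun s => F s y) xi).
    { intros y h; apply (@ex_derive_continuous R_AbsRing R_NormedModule).
      eexists; apply dFx; auto. }
    assert (L1 : locally xi (fun s => F s (Y xi - e) < k)).
    { refine (cF _ _ (fun z => z < k) _); [unfold channel; lra|]; apply open_lt.
      rewrite <- GF by lra; rewrite <- (YG xi); apply Ginc; lra. }
    assert (L2 : locally xi (fun s => k < F s (Y xi + e))).
    { refine (cF _ _ (fun z => k < z) _); [unfold channel; lra|]; apply open_gt.
      rewrite <- GF by lra; rewrite <- (YG xi); apply Ginc; lra. }
    destruct (filter_and _ _ L1 L2) as [d Hd].
    exists d; split; [apply cond_pos|]; intros s [_ hs].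
    destruct (Hd s hs) as [K1 K2]; rewrite <- GF in K1, K2 by lra.
    rewrite <- (YG s) in K1, K2; specialize (Yr s) as hys.
    simpl; unfold Rdist; apply Rle_lt_trans with e; [|lra].
    apply Rabs_le; split; apply Rnot_lt_le; intros h.
    - assert (G s (Y s) < G s (Y xi - e)) by (apply Ginc; lra); lra.
    - assert (G s (Y xi + e) < G s (Y s)) by (apply Ginc; lra); lra. }
  assert (dY : forall xi,
    is_derive Y xi (- - (partial_derive 1 0 q xi (Y xi) / c) / Fy xi (Y xi))).
  { intros xi; apply (implicit_is_derive F Y xi _ _ k); [| apply Fy0, Yr | auto | auto].
    apply (differentiable_pt_lim_channel F
             (fun xi y => - (partial_derive 1 0 q xi y / c))); auto.
    - apply Yr.
    - apply (is_derive_ext_loc (G xi)).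
      + apply interval_locally; auto; intros t ht; apply GF; lra.
      + apply dG, Yr.
    - apply continuity_2d_pt_opp, continuity_2d_pt_mult.
      + apply (Cn_pd_continuous 1); auto; apply Yr.
      + apply continuity_2d_pt_const. }
  assert (dZ : forall xi, is_derive (fun s => rc s (Y s)) xi 0).
  { intros xi; specialize (Yr xi) as hy.
    (* The zero is written in the form the chain rule delivers. The slope of [Y] is v / (u - c), so
       the sum vanishes by the transport equation [Ht]. *)
    replace 0 with (partial_derive 1 0 rc xi (Y xi) * 1
      + partial_derive 0 1 rc xi (Y xi)
        * (- - (partial_derive 1 0 q xi (Y xi) / c) / Fy xi (Y xi))).
    - apply is_derive_Reals.
      apply (derivable_pt_lim_comp_2d rc (fun s => s) Y).
      + apply (differentiable_pt_lim_channel rc (partial_derive 1 0 rc)); auto.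
        * intros a b hab; apply (Cn_is_derive_xi 1 0 0 rc); auto.
        * apply (Cn_is_derive_y 1 0 0 rc); auto.
        * apply (Cn_pd_continuous 1); auto.
      + apply derivable_pt_lim_id.
      + apply is_derive_Reals, dY.
    - specialize (Ht xi (Y xi) hy); specialize (hden xi (Y xi) hy).
      specialize (Fy0 xi (Y xi) hy).
      apply (Rmult_eq_reg_l (partial_derive 0 1 q xi (Y xi) - c)); auto.
      rewrite Rmult_0_r, <- Ht; unfold Fy; field; split; auto.
      intros hz; apply hden; lra. }
  (* The tolerance is the lower bound m of the stratification: far out the density exceeds [rb - m],
     which is nonnegative. The abscissa [xi1] lies beyond the threshold and to the right of
     [xi0]. *)
  destruct (Hlim m hm) as [M HM].
  set (xi1 := Rmax (Rabs M) (Rabs xi0) + 1).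
  assert (h1 : Rabs M < xi1) by (pose proof (Rmax_l (Rabs M) (Rabs xi0)); unfold xi1; lra).
  assert (h2 : Rabs xi0 < xi1) by (pose proof (Rmax_r (Rabs M) (Rabs xi0)); unfold xi1; lra).
  assert (h3 : xi0 < xi1) by (pose proof (Rle_abs xi0); lra).
  assert (Y0 : Y xi0 = y0).
  { specialize (Yr xi0) as hy; specialize (YG xi0) as E; unfold k in E.
    destruct (Rtotal_order (Y xi0) y0) as [h | [h | h]]; auto.
    - assert (G xi0 (Y xi0) < G xi0 y0) by (apply Ginc; lra); lra.
    - assert (G xi0 y0 < G xi0 (Y xi0)) by (apply Ginc; lra); lra. }
  assert (E : rc xi0 (Y xi0) = rc xi1 (Y xi1))
    by (apply (eq_is_derive (fun s => rc s (Y s)) xi0 xi1); auto).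
  rewrite <- Y0, E; specialize (Yr xi1) as hy.
  assert (A : Rabs (rc xi1 (Y xi1) - rb (Y xi1)) < m).
  { apply HM; [|lra]; rewrite (Rabs_right xi1).
    - pose proof (Rle_abs M); lra.
    - pose proof (Rabs_pos M); lra. }
  apply Rabs_def2 in A; specialize (Hm (Y xi1) ltac:(lra)); lra.
Qed.

(** * Differentiation in W *)

Section Fatou.

Import all_boot all_order all_algebra.
Import all_classical all_reals all_analysis measurable_realfun.
Import Rstruct Rstruct_topology.
Import Order.TTheory GRing.Theory Num.Theory.
Import numFieldNormedType.Exports.

Local Open Scope classical_set_scope.
Local Open Scope ring_scope.

(** Fatou bounds the integral of the limit function by 0, and a nonnegative function with zero
    integral vanishes almost everywhere. *)
Lemma Fatou_ae_eq0 d (T : measurableType d) (K : realType)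
    (mu : {measure set T -> \bar K}) (D : set T) (F : nat -> T -> K) (f : T -> K) :
  measurable D -> (forall n, measurable_fun D (F n)) ->
  (forall n x, D x -> 0 <= F n x) -> (forall x, D x -> F^~ x @ \oo --> f x) ->
  (fun n => (\int[mu]_(x in D) (F n x)%:E)%E) @ \oo --> 0%E ->
  {ae mu, forall x, D x -> f x = 0}.
Proof.
move=> mD mF F0 Ff intF.
have mf : measurable_fun D f by exact: (measurable_fun_cvg mF Ff).
have f0 x : D x -> (0 <= (f x)%:E)%E.
  move=> Dx; rewrite lee_fin.
  by apply: (cvgr_to_ge (Ff _ Dx)); apply: nearW => n; exact: F0.
have mFE n : measurable_fun D (EFin \o F n) by exact/measurable_EFinP.
have mfE : measurable_fun D (EFin \o f) by exact/measurable_EFinP.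
have FE0 n x : D x -> (0 <= (EFin \o F n) x)%E by move=> Dx; rewrite lee_fin F0.
have := fatou mu mD mFE FE0.
rewrite (cvg_limn_einf_sup intF).1 => le0.
have /(ae_eq_integral_abs mu mD mfE) : (\int[mu]_(x in D) `|(EFin \o f) x| = 0)%E.
  apply/eqP; rewrite eq_le integral_ge0// andbT.
  apply: le_trans le0; rewrite le_eqVlt; apply/orP; left; apply/eqP.
  apply: eq_integral => x /set_mem Dx; rewrite gee0_abs; last exact: f0.
  apply/esym; apply: (cvg_limn_einf_sup _).1.
  by apply: cvg_EFin; [exact: nearW | exact: Ff].
by apply: filterS => x H Dx; case: (H Dx).
Qed.

Local Notation oo a b := (Interval (BRight a) (BLeft b)).

(** A nonzero value persists on a whole interval by continuity, and an interval of positive length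
    does not fit into a null set. *)
Lemma ae_eq0_continuous (K : realType) (a b : K) (f : K -> K) :
  {in oo a b, continuous f} ->
  {ae @lebesgue_measure K, forall x, x \in oo a b -> f x = 0} ->
  {in oo a b, forall x, f x = 0}.
Proof.
move=> cf [N [mN N0 subN]] x xab; apply: contrapT => fx0.
have : \forall z \near x, z \in oo a b /\ f z <> 0.
  near=> z; split.
    near: z; exact: near_in_itvoo.
  apply/eqP; near: z.
  exact: (cvgr_neq0 _ (cf x xab) (introN eqP fx0)).
move=> /nbhs_ballP[e /= e0 sub].
have eN : [set` oo (x - e) (x + e)] `<=` N.
  move=> z; rewrite -ball_itv => /sub [zab fz].
  by apply: subN => /= H; exact/fz/H.
have : (lebesgue_measure [set` oo (x - e)%R (x + e)%R] <= lebesgue_measure N)%E.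
  by apply: le_measure => //; rewrite inE.
have xe : x - e < x + e by rewrite ltrD2l gtrN.
rewrite N0 lebesgue_measure_itv /= lte_fin xe -EFinB lee_fin subr_le0.
by rewrite leNgt xe.
Unshelve. all: by end_near.
Qed.

End Fatou.

(** * Measurability and integration on the unit interval *)

Section UnitInterval.

Import all_boot all_order all_algebra.
Import all_classical all_reals all_analysis measurable_realfun.
Import Rstruct Rstruct_topology.
Import Reals Coquelicot.
Open Scope R_scope.
Import Order.TTheory GRing.Theory Num.Theory.
Import numFieldNormedType.Exports.

Lemma Un_cv_cvg (u : nat -> R) (l : R) : Un_cv u l -> (u @ \oo --> l)%classic.
Proof.
move=> H.
suff K : forall e : R, Order.lt 0 e ->
    (\forall n \near \oo, Order.lt (Num.norm (GRing.add l (GRing.opp (u n)))) e)%classic.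
  exact: (iffRL (cvgrPdist_lt (V := RbaseSymbolsImpl_R__canonical__reals_Real) u l) K).
move=> e /RltP he; have [N HN] := H e he.
exists N => // n /= Nn; rewrite distrC.
by apply/RltP; exact: HN (elimT ssrnat.leP Nn).
Qed.

Definition meas (f : R -> R) : Prop :=
  measurable_fun unit_interval
    (fun y : measurableTypeR R => f y : measurableTypeR R).

Lemma unit_intervalE :
  unit_interval = [set` Interval (BRight 0) (BLeft 1)]%classic.
Proof.
apply/seteqP; split=> y /=; rewrite in_itv /=.
  by move=> [/RltP h0 /RltP h1]; apply/andP.
by move=> /andP [/RltP h0 /RltP h1].
Qed.

Lemma measurable_unit_interval :
  measurable (unit_interval : set (measurableTypeR R)).
Proof. by rewrite unit_intervalE; exact: measurable_itv. Qed.

Lemma meas_ext (f h : R -> R) :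
  (forall y, 0 < y < 1 -> f y = h y) -> meas f -> meas h.
Proof. by move=> E; apply: eq_measurable_fun => y /set_mem hy; exact: E. Qed.

Lemma meas_continuous (f : R -> R) :
  (forall y, 0 < y < 1 -> continuity_pt f y) -> meas f.
Proof.
move=> Hf; apply: open_continuous_measurable_fun.
  by rewrite unit_intervalE; exact: interval_open.
by move=> y /set_mem hy; apply/continuity_ptE; exact: Hf.
Qed.

Lemma meas_plus (f h : R -> R) : meas f -> meas h -> meas (fun y => f y + h y).
Proof. by move=> hf hh; exact: (measurable_funD hf hh). Qed.

Lemma meas_mult (f h : R -> R) : meas f -> meas h -> meas (fun y => f y * h y).
Proof. by move=> hf hh; exact: (measurable_funM hf hh). Qed.

Lemma meas_const (k : R) : meas (fun=> k).
Proof. exact: measurable_cst. Qed.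

Lemma meas_lim (F : nat -> R -> R) (f : R -> R) :
  (forall n, meas (F n)) ->
  (forall y, 0 < y < 1 -> Un_cv (F^~ y) (f y)) -> meas f.
Proof.
move=> mF H.
have K (y : R) : unit_interval y -> (F^~ y @ \oo --> f y)%classic.
  by move=> hy; exact/Un_cv_cvg/H.
exact: (measurable_fun_cvg mF K).
Qed.

Lemma integral_unit_interval_ae_eq (f h : R -> R) :
  meas f -> meas h ->
  (forall y, 0 < y < 1 -> 0 <= f y) -> (forall y, 0 < y < 1 -> 0 <= h y) ->
  {ae @lebesgue_measure R, forall y, unit_interval y -> f y = h y} ->
  (\int[@lebesgue_measure R]_(y in unit_interval) (f y)%:E =
   \int[@lebesgue_measure R]_(y in unit_interval) (h y)%:E)%E.
Proof.
move=> mf mh f0 h0 H; apply: ge0_ae_eq_integral.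
- exact: measurable_unit_interval.
- by apply/measurable_EFinP; exact: mf.
- by apply/measurable_EFinP; exact: mh.
- by move=> y hy; rewrite lee_fin; apply/RleP; exact: f0.
- by move=> y hy; rewrite lee_fin; apply/RleP; exact: h0.
- by move: H; apply: filterS => y H hy; rewrite H.
Qed.

Lemma ae_zero_of_integral_lim (F : nat -> R -> R) (f : R -> R) :
  (forall n, meas (F n)) ->
  (forall n y, 0 < y < 1 -> 0 <= F n y) ->
  (forall y, 0 < y < 1 -> Un_cv (F^~ y) (f y)) ->
  (forall eps : R, 0 < eps -> exists N, forall n, (N <= n)%coq_nat ->
     (\int[@lebesgue_measure R]_(y in unit_interval) (F n y)%:E <= eps%:E)%E) ->
  {ae @lebesgue_measure R, forall y, unit_interval y -> f y = 0}.
Proof.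
move=> mF F0 Ff Fint.
have F0' n (y : R) : unit_interval y -> (0 <= (F n y)%:E)%E.
  by move=> hy; rewrite lee_fin; apply/RleP; exact: F0.
apply: (@Fatou_ae_eq0 _ (measurableTypeR R) R (@lebesgue_measure R)
          unit_interval F f measurable_unit_interval mF).
- by move=> n y hy; apply/RleP; exact: F0.
- by move=> y hy; exact/Un_cv_cvg/Ff.
have i0 n : (0 <= \int[@lebesgue_measure R]_(y in unit_interval) (F n y)%:E)%E.
  by apply: integral_ge0 => y hy; exact: F0'.
(* Convergence of extended reals to a finite limit is eventual finiteness plus convergence of the
   finite parts; the bound with eps = 1 gives the former. *)
apply/fine_cvgP; split.
  have [N HN] := Fint 1 Rlt_0_1.
  exists N => // n /= Nn; rewrite ge0_fin_numE //.
  by apply: le_lt_trans (ltry 1); exact: HN (elimT ssrnat.leP Nn).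
apply: Un_cv_cvg => e he.
(* Halving makes the non-strict bound on the integrals strict. *)
have he2 : 0 < e / 2 by lra.
have [N HN] := Fint (e / 2) he2.
exists N => n Nn.
have ie := HN n Nn.
rewrite /Rdist /= Rminus_0_r Rabs_right.
  apply: (Rle_lt_trans _ (e / 2)); last lra.
  apply/RleP; rewrite -lee_fin fineK // ge0_fin_numE //.
  exact: le_lt_trans ie (ltry _).
by apply: Rle_ge; apply/RleP; exact: fine_ge0.
Qed.

Lemma ae_zero_everywhere (f : R -> R) :
  (forall y, 0 < y < 1 -> continuity_pt f y) ->
  {ae @lebesgue_measure R, forall y, unit_interval y -> f y = 0} ->
  forall y, 0 < y < 1 -> f y = 0.
Proof.
move=> cf H y hy.
have E z : (z \in Interval (BRight 0) (BLeft 1)) <-> unit_interval z.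
  by rewrite unit_intervalE.
apply: (@ae_eq0_continuous R 0 1 f); last exact/E.
- by move=> z /E hz; apply/continuity_ptE; exact: cf.
- by move: H; apply: filterS => z Hz /E; exact: Hz.
Qed.

End UnitInterval.

(** * Norm derivative against pointwise derivative in the weighted space *)

Section Wderivative.

Import all_boot all_order all_algebra.
Import all_classical all_reals all_analysis measurable_realfun.
Import Rstruct Rstruct_topology.
Import Reals Coquelicot.
Open Scope R_scope.

Definition sqmod (z : C) : R := Re z * Re z + Im z * Im z.

Lemma sqmod_ge0 (z : C) : 0 <= sqmod z.
Proof. unfold sqmod; nra. Qed.

Lemma sqmod_eq0 (z : C) : sqmod z = 0 -> z = RtoC 0.
Proof.
destruct z as [a b]; unfold sqmod; simpl; intros h.
assert (a = 0) by nra; assert (b = 0) by nra; subst; reflexivity.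
Qed.

Lemma Cmod_sqmod (z : C) : Cmod z * Cmod z = sqmod z.
Proof.
unfold Cmod, sqmod, Re, Im; rewrite sqrt_sqrt; [ring|].
apply Rplus_le_le_0_compat; apply pow2_ge_0.
Qed.

(** On the diagonal the density is a sum of squares with weight -1/rb' in the first component and
    -rb' in the others. Both are positive where the stratification decreases, whence nonnegativity
    and definiteness below. *)
Lemma Re_Wdensity (rb : R -> R) (V : Wvec) (y : R) :
  Derive rb y <> 0 ->
  Re (Wdensity rb V V y) =
  - / Derive rb y * sqmod (w1 V y)
  + - Derive rb y * (sqmod (w2 V y) + sqmod (w3 V y) + sqmod (w4 V y)).
Proof.
intros hd; unfold Wdensity, Cdiv; rewrite <- RtoC_mult, <- RtoC_inv by nra.
destruct (w1 V y), (w2 V y), (w3 V y), (w4 V y).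
unfold sqmod; simpl; field; exact hd.
Qed.

Lemma Re_Wdensity_ge0 (rb : R -> R) (V : Wvec) (y : R) :
  Derive rb y < 0 -> 0 <= Re (Wdensity rb V V y).
Proof.
intros hd; rewrite Re_Wdensity; [|lra].
assert (hi : / Derive rb y < 0) by now apply Rinv_lt_0_compat.
pose proof (sqmod_ge0 (w1 V y)); pose proof (sqmod_ge0 (w2 V y)).
pose proof (sqmod_ge0 (w3 V y)); pose proof (sqmod_ge0 (w4 V y)).
apply Rplus_le_le_0_compat; apply Rmult_le_pos; lra.
Qed.

Lemma Re_Wdensity_eq0 (rb : R -> R) (V : Wvec) (y : R) :
  Derive rb y < 0 -> Re (Wdensity rb V V y) = 0 ->
  w1 V y = RtoC 0 /\ w2 V y = RtoC 0 /\ w3 V y = RtoC 0 /\ w4 V y = RtoC 0.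
Proof.
intros hd; rewrite Re_Wdensity; [|lra]; intros E.
assert (hi : / Derive rb y < 0) by now apply Rinv_lt_0_compat.
pose proof (sqmod_ge0 (w1 V y)); pose proof (sqmod_ge0 (w2 V y)).
pose proof (sqmod_ge0 (w3 V y)); pose proof (sqmod_ge0 (w4 V y)).
repeat split; apply sqmod_eq0; nra.
Qed.

Definition measC (w : R -> C) : Prop :=
  meas (fun y => Re (w y)) /\ meas (fun y => Im (w y)).

Definition measW (V : Wvec) : Prop :=
  measC (w1 V) /\ measC (w2 V) /\ measC (w3 V) /\ measC (w4 V).

Lemma inW_measW (V : Wvec) : inW V -> measW V.
Proof.
intros [[a [b _]] [[c [d _]] [[e [f _]] [k [l _]]]]].
repeat split; assumption.
Qed.

Lemma meas_sqmod (w : R -> C) : measC w -> meas (fun y => sqmod (w y)).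
Proof. intros [h1 h2]; apply meas_plus; apply meas_mult; assumption. Qed.

Lemma measC_quotient_error (k : R) (w w' z : R -> C) :
  measC w -> measC w' -> measC z ->
  measC (fun y => Cminus (Cmult (RtoC k) (Cminus (w y) (w' y))) (z y)).
Proof.
assert (K : forall f f' h, meas f -> meas f' -> meas h ->
  meas (fun y => k * (f y + (-1) * f' y) + (-1) * h y)).
{ intros f f' h hf hf' hh; apply meas_plus.
  - apply meas_mult; [apply meas_const|].
    apply meas_plus; [exact hf|]; apply meas_mult; [apply meas_const | exact hf'].
  - apply meas_mult; [apply meas_const | exact hh]. }
intros [h1 h2] [h3 h4] [h5 h6]; split.
- apply (meas_ext (fun y => k * (Re (w y) + (-1) * Re (w' y)) + (-1) * Re (z y)));
    [intros y _; simpl; unfold Re; ring | now apply K].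
- apply (meas_ext (fun y => k * (Im (w y) + (-1) * Im (w' y)) + (-1) * Im (z y)));
    [intros y _; simpl; unfold Im; ring | now apply K].
Qed.

Lemma Un_cv_eq (u v : nat -> R) (l k : R) :
  Un_cv u l -> (forall n, u n = v n) -> l = k -> Un_cv v k.
Proof.
intros H E <- e he; destruct (H e he) as [N HN]; exists N; intros n hn.
now rewrite <- E; apply HN.
Qed.

Section Derivative.

Variable rb : R -> R.
Hypothesis rb_neg : forall y, 0 < y < 1 -> Derive rb y < 0.
Hypothesis rb_cont : forall y, 0 < y < 1 -> continuity_pt (Derive rb) y.

Lemma meas_Wdensity (V : Wvec) :
  measW V -> meas (fun y => Re (Wdensity rb V V y)).
Proof.
intros (h1 & h2 & h3 & h4).
apply (meas_ext (fun y =>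
  - / Derive rb y * sqmod (w1 V y)
  + - Derive rb y * (sqmod (w2 V y) + sqmod (w3 V y) + sqmod (w4 V y)))).
{ intros y hy; symmetry; apply Re_Wdensity.
  specialize (rb_neg y hy); lra. }
apply meas_plus; apply meas_mult.
- apply meas_continuous; intros y hy; apply continuity_pt_opp.
  apply continuity_pt_inv; [now apply rb_cont|].
  specialize (rb_neg y hy); lra.
- now apply meas_sqmod.
- apply meas_continuous; intros y hy; apply continuity_pt_opp; now apply rb_cont.
- apply meas_plus; [apply meas_plus|]; now apply meas_sqmod.
Qed.

Variables (W : R -> Wvec) (xi : R) (V : Wvec).
Hypothesis W_meas : forall s, measW (W s).
Hypothesis W_derive : forall y, 0 < y < 1 ->
  is_deriveC (fun s => w1 (W s) y) xi (w1 V y) /\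
  is_deriveC (fun s => w2 (W s) y) xi (w2 V y) /\
  is_deriveC (fun s => w3 (W s) y) xi (w3 V y) /\
  is_deriveC (fun s => w4 (W s) y) xi (w4 V y).

Definition quotient_error (h : R) (D : Wvec) : Wvec :=
  Wsub (Wscale (/ h) (Wsub (W (xi + h)) (W xi))) D.

Lemma measW_quotient_error (h : R) (D : Wvec) :
  measW D -> measW (quotient_error h D).
Proof.
intros (d1 & d2 & d3 & d4).
destruct (W_meas (xi + h)) as (a1 & a2 & a3 & a4).
destruct (W_meas xi) as (b1 & b2 & b3 & b4).
split; [|split; [|split]]; now apply measC_quotient_error.
Qed.

(** Fatou's lemma and the measurability of limits concern sequences, so the increment h is sampled
    at the nonzero values 1/(n+1). *)
Let hseq (n : nat) : R := / INR n.+1.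

Lemma hseq_pos (n : nat) : 0 < hseq n.
Proof. apply Rinv_0_lt_compat, lt_0_INR, Nat.lt_0_succ. Qed.

Lemma hseq_small (d : R) : 0 < d ->
  exists N, forall n, (n >= N)%coq_nat -> Rabs (hseq n) < d.
Proof.
intros hd; destruct (archimed_cor1 d hd) as (N & hN & hN0).
exists N; intros n hn; rewrite Rabs_right; [|left; apply hseq_pos].
apply Rle_lt_trans with (/ INR N); [|exact hN].
apply Rinv_le_contravar; [now apply lt_0_INR|].
apply le_INR; apply (Nat.le_trans _ n); [exact hn | apply Nat.le_succ_diag_r].
Qed.

Lemma Un_cv_quotient (f : R -> R) (l : R) :
  is_derive f xi l ->
  Un_cv (fun n => / hseq n * (f (xi + hseq n) - f xi)) l.
Proof.
intros H e he; apply is_derive_Reals in H.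
destruct (H e he) as [d Hd]; destruct (hseq_small d (cond_pos d)) as [N HN].
exists N; intros n hn; unfold Rdist; rewrite Rmult_comm.
apply Hd; [|now apply HN].
pose proof (hseq_pos n); lra.
Qed.

Lemma Un_cv_sqmod (f : R -> C) (l k : C) :
  is_deriveC f xi l ->
  Un_cv (fun n => sqmod (Cminus (Cmult (RtoC (/ hseq n))
                    (Cminus (f (xi + hseq n)) (f xi))) k))
        (sqmod (Cminus l k)).
Proof.
intros [H1 H2].
assert (K : forall a, Un_cv (fun _ => a) a).
{ intros a e he; exists O; intros n _; unfold Rdist.
  now rewrite Rminus_diag Rabs_R0. }
assert (C1 := CV_minus _ _ _ _ (Un_cv_quotient _ _ H1) (K (Re k))).
assert (C2 := CV_minus _ _ _ _ (Un_cv_quotient _ _ H2) (K (Im k))).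
apply (Un_cv_eq _ _ _ _ (CV_plus _ _ _ _ (CV_mult _ _ _ _ C1 C1) (CV_mult _ _ _ _ C2 C2))).
- intros n; unfold sqmod, Re, Im; simpl; ring.
- unfold sqmod, Re, Im; simpl; ring.
Qed.

Lemma is_Wderive_quotient (D : Wvec) :
  is_Wderive rb W xi D ->
  forall eps, 0 < eps -> exists N, forall n, (N <= n)%coq_nat ->
    (Wsqnorm rb (quotient_error (hseq n) D) <= eps%:E)%E.
Proof.
intros [_ H] eps heps; destruct (H eps heps) as (d & hd & Hd).
destruct (hseq_small d hd) as [N HN]; exists N; intros n hn; apply Hd.
split; [|now apply HN].
rewrite Rabs_right; [apply hseq_pos | left; apply hseq_pos].
Qed.

Lemma Un_cv_Wdensity (D : Wvec) (y : R) : 0 < y < 1 ->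
  Un_cv (fun n => Re (Wdensity rb (quotient_error (hseq n) D)
                                  (quotient_error (hseq n) D) y))
        (Re (Wdensity rb (Wsub V D) (Wsub V D) y)).
Proof.
intros hy; destruct (W_derive y hy) as (D1 & D2 & D3 & D4).
assert (hn : Derive rb y <> 0) by (specialize (rb_neg y hy); lra).
assert (K : forall a, Un_cv (fun _ => a) a).
{ intros a e he; exists O; intros n _; unfold Rdist.
  now rewrite Rminus_diag Rabs_R0. }
apply (Un_cv_eq _ _ _ _ (CV_plus _ _ _ _
  (CV_mult _ _ _ _ (K (- / Derive rb y)) (Un_cv_sqmod _ _ (w1 D y) D1))
  (CV_mult _ _ _ _ (K (- Derive rb y))
     (CV_plus _ _ _ _ (CV_plus _ _ _ _ (Un_cv_sqmod _ _ (w2 D y) D2)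
                                       (Un_cv_sqmod _ _ (w3 D y) D3))
                      (Un_cv_sqmod _ _ (w4 D y) D4))))).
- intros n; rewrite Re_Wdensity; [reflexivity | exact hn].
- rewrite Re_Wdensity; [reflexivity | exact hn].
Qed.

(** The densities of the quotient errors tend pointwise to that of [Wsub V D], while their integrals
    tend to 0. The limit density thus vanishes almost everywhere, and definiteness separates it into
    the four components. *)
Lemma is_Wderive_ae (D : Wvec) :
  is_Wderive rb W xi D ->
  {ae @lebesgue_measure R, forall y, unit_interval y ->
     w1 V y = w1 D y /\ w2 V y = w2 D y /\ w3 V y = w3 D y /\ w4 V y = w4 D y}.
Proof.
intros HD; assert (mD := inW_measW _ (proj1 HD)).
assert (H := ae_zero_of_integral_lim
  (fun n y => Re (Wdensity rb (quotient_error (hseq n) D)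
                              (quotient_error (hseq n) D) y))
  (fun y => Re (Wdensity rb (Wsub V D) (Wsub V D) y))).
have := H _ _ _ (is_Wderive_quotient D HD) => {}H.
have : {ae @lebesgue_measure R, forall y, unit_interval y ->
     Re (Wdensity rb (Wsub V D) (Wsub V D) y) = 0}.
  apply: H.
  - by move=> n; apply: meas_Wdensity; apply: measW_quotient_error.
  - by move=> n y hy; apply: Re_Wdensity_ge0; exact: rb_neg.
  - by move=> y hy; exact: Un_cv_Wdensity.
apply: filterS => y Hy hy.
have [e1 [e2 [e3 e4]]] := Re_Wdensity_eq0 _ _ _ (rb_neg y hy) (Hy hy).
have K (a b : C) : Cminus a b = RtoC 0 -> a = b.
  by move=> E; rewrite -(Cplus_0_r b) -E; unfold Cminus; ring.
by split; [|split; [|split]]; apply: K.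
Qed.

(** A derivative is a pointwise limit of measurable difference quotients. Measurability of z is what
    later allows its integrals to be compared with those of a function equal to it almost
    everywhere. *)
Lemma measC_derive (w : R -> R -> C) (z : R -> C) :
  (forall s, measC (w s)) ->
  (forall y, 0 < y < 1 -> is_deriveC (fun s => w s y) xi (z y)) -> measC z.
Proof.
intros Hw Hz.
assert (K : forall f f' a, meas f -> meas f' -> meas (fun y => a * (f y - f' y))).
{ intros f f' a hf hf'; apply (meas_ext (fun y => a * (f y + (-1) * f' y))).
  - intros y _; ring.
  - apply meas_mult; [apply meas_const|]; apply meas_plus; [exact hf|].
    apply meas_mult; [apply meas_const | exact hf']. }
split.
- apply (meas_lim (fun n y => / hseq n * (Re (w (xi + hseq n) y) - Re (w xi y)))).
  + intros n; apply K; [exact (proj1 (Hw _)) | exact (proj1 (Hw _))].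
  + intros y hy; apply (Un_cv_quotient (fun s => Re (w s y))), Hz, hy.
- apply (meas_lim (fun n y => / hseq n * (Im (w (xi + hseq n) y) - Im (w xi y)))).
  + intros n; apply K; [exact (proj2 (Hw _)) | exact (proj2 (Hw _))].
  + intros y hy; apply (Un_cv_quotient (fun s => Im (w s y))), Hz, hy.
Qed.

Lemma measW_derive : measW V.
Proof.
split; [|split; [|split]].
- exact (measC_derive (fun s => w1 (W s)) (w1 V)
    (fun s => proj1 (W_meas s))
    (fun y hy => proj1 (W_derive y hy))).
- exact (measC_derive (fun s => w2 (W s)) (w2 V)
    (fun s => proj1 (proj2 (W_meas s)))
    (fun y hy => proj1 (proj2 (W_derive y hy)))).
- exact (measC_derive (fun s => w3 (W s)) (w3 V)
    (fun s => proj1 (proj2 (proj2 (W_meas s))))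
    (fun y hy => proj1 (proj2 (proj2 (W_derive y hy))))).
- exact (measC_derive (fun s => w4 (W s)) (w4 V)
    (fun s => proj2 (proj2 (proj2 (W_meas s))))
    (fun y hy => proj2 (proj2 (proj2 (W_derive y hy))))).
Qed.

(** The derivative D comes without a formula. Since V agrees with it almost everywhere, square
    integrability and the error bounds, being statements about integrals, pass on to the explicit
    V. *)
Lemma is_Wderive_pointwise (D : Wvec) :
  is_Wderive rb W xi D -> is_Wderive rb W xi V.
Proof.
intros HD; assert (HE := is_Wderive_ae D HD).
assert (mV := measW_derive).
assert (mD := inW_measW _ (proj1 HD)).
split.
- assert (K : forall w z : R -> C, measC w -> in_L2 z ->
    {ae @lebesgue_measure R, forall y, unit_interval y -> w y = z y} -> in_L2 w).
  { intros w z hw [z1 [z2 z3]] E; split; [apply hw|]; split; [apply hw|].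
    move: z3; rewrite (integral_unit_interval_ae_eq (fun y => Cmod (w y) * Cmod (w y))
      (fun y => Cmod (z y) * Cmod (z y))) //.
    - apply (meas_ext (fun y => sqmod (w y)));
        [intros y _; now rewrite Cmod_sqmod | now apply meas_sqmod].
    - apply (meas_ext (fun y => sqmod (z y)));
        [intros y _; now rewrite Cmod_sqmod | apply meas_sqmod; now split].
    - intros y _; rewrite Cmod_sqmod; apply sqmod_ge0.
    - intros y _; rewrite Cmod_sqmod; apply sqmod_ge0.
    - by move: E; apply: filterS => y E hy; rewrite E. }
  destruct mV as (v1 & v2 & v3 & v4), HD as [(d1 & d2 & d3 & d4) _].
  split; [|split; [|split]].
  + apply: (K _ _ v1 d1); move: HE; apply: filterS => y E hy.
    by have [E1 [E2 [E3 E4]]] := E hy.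
  + apply: (K _ _ v2 d2); move: HE; apply: filterS => y E hy.
    by have [E1 [E2 [E3 E4]]] := E hy.
  + apply: (K _ _ v3 d3); move: HE; apply: filterS => y E hy.
    by have [E1 [E2 [E3 E4]]] := E hy.
  + apply: (K _ _ v4 d4); move: HE; apply: filterS => y E hy.
    by have [E1 [E2 [E3 E4]]] := E hy.
- intros eps heps; destruct (proj2 HD eps heps) as (d & hd & Hd).
  exists d; split; [exact hd|]; intros h hh.
  have -> : Wsqnorm rb (Wsub (Wscale (/ h) (Wsub (W (xi + h)) (W xi))) V)
          = Wsqnorm rb (Wsub (Wscale (/ h) (Wsub (W (xi + h)) (W xi))) D).
    apply: integral_unit_interval_ae_eq.
    + apply: meas_Wdensity; exact: measW_quotient_error.
    + apply: meas_Wdensity; exact: measW_quotient_error.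
    + by move=> y hy; apply: Re_Wdensity_ge0; exact: rb_neg.
    + by move=> y hy; apply: Re_Wdensity_ge0; exact: rb_neg.
    + move: HE; apply: filterS => y E hy; have [E1 [E2 [E3 E4]]] := E hy.
      by rewrite /Wdensity /= E1 E2 E3 E4.
  exact: Hd.
Qed.

Lemma continuousC_ae_eq (w z : R -> C) :
  (forall y, 0 < y < 1 -> continuousC w y) ->
  (forall y, 0 < y < 1 -> continuousC z y) ->
  {ae @lebesgue_measure R, forall y, unit_interval y -> w y = z y} ->
  forall y, 0 < y < 1 -> w y = z y.
Proof.
intros cw cz E y hy.
assert (H1 : Re (w y) - Re (z y) = 0).
{ apply (ae_zero_everywhere (fun y => Re (w y) - Re (z y))); [| |exact hy].
  - intros t ht; apply continuity_pt_minus; [apply cw, ht | apply cz, ht].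
  - by move: E; apply: filterS => t E ht; rewrite E // Rminus_diag. }
assert (H2 : Im (w y) - Im (z y) = 0).
{ apply (ae_zero_everywhere (fun y => Im (w y) - Im (z y))); [| |exact hy].
  - intros t ht; apply continuity_pt_minus; [apply cw, ht | apply cz, ht].
  - by move: E; apply: filterS => t E ht; rewrite E // Rminus_diag. }
destruct (w y), (z y); unfold Re, Im in *; simpl in *; f_equal; lra.
Qed.

(** Only the outer components are compared, because the second and third rows of the operator return
    the derivatives already stored in W. *)
Lemma is_Wderive_unique (D : Wvec) :
  is_Wderive rb W xi D ->
  (forall y, 0 < y < 1 -> continuousC (w1 V) y /\ continuousC (w1 D) y) ->
  (forall y, 0 < y < 1 -> continuousC (w4 V) y /\ continuousC (w4 D) y) ->
  forall y, 0 < y < 1 -> w1 V y = w1 D y /\ w4 V y = w4 D y.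
Proof.
intros HD c1 c4 y hy; assert (HE := is_Wderive_ae D HD); split.
- apply: continuousC_ae_eq hy; [by move=> t /c1 [] | by move=> t /c1 [] |].
  by move: HE; apply: filterS => t E ht; have [E1 [E2 [E3 E4]]] := E ht.
- apply: continuousC_ae_eq hy; [by move=> t /c4 [] | by move=> t /c4 [] |].
  by move: HE; apply: filterS => t E ht; have [E1 [E2 [E3 E4]]] := E ht.
Qed.

End Derivative.

End Wderivative.

(** * Wave and stream function *)

Lemma stratification_quotient (rb : R -> R) (y : R) :
  stratification rb -> 0 <= y <= 1 ->
  exists l, l < 0 /\ forall eps, 0 < eps -> exists d : posreal,
    forall z, Rabs (z - y) < d -> z <> y -> 0 <= z <= 1 ->
      Rabs ((rb z - rb y) / (z - y) - l) < eps.
Proof.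
  intros H hy; destruct (H y hy) as (_ & l & hl & L).
  exists l; split; auto; intros eps heps.
  destruct (L (fun z => Rabs (z - l) < eps)) as [d Hd].
  - exists (mkposreal eps heps); intros z hz; exact hz.
  - exists d; intros z h1 h2 h3; exact (Hd z h1 h2 h3).
Qed.

(** Around an interior point small increments stay in [0,1], so the derivative relative to [0,1] is
    the ordinary one. *)
Lemma stratification_Derive_neg (rb : R -> R) (y : R) :
  stratification rb -> 0 < y < 1 -> Derive rb y < 0.
Proof.
  intros H hy; destruct (stratification_quotient rb y H) as (l & hl & L); [lra|].
  rewrite (is_derive_unique rb y l); auto.
  apply is_derive_Reals; intros eps heps.
  destruct (L eps heps) as [d Hd].
  destruct (interval_locally (fun t => 0 <= t <= 1) y hy) as [d' Hd'];
    [intros; lra|].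
  assert (hm : 0 < Rmin d d') by (apply Rmin_pos; apply cond_pos).
  exists (mkposreal _ hm); simpl; intros h hh hlt.
  pose proof (Rmin_l d d'); pose proof (Rmin_r d d').
  specialize (Hd (y + h)); replace (y + h - y) with h in Hd by ring.
  apply Hd; try lra.
  apply Hd'; change (Rabs (y + h - y) < d').
  replace (y + h - y) with h by ring; lra.
Qed.

(** A positive continuous function attains a positive minimum on [0,1]. Continuity, one-sided at the
    walls, follows because difference quotients near y are bounded by [Rabs l + 1]. *)
Lemma stratification_lower_bound (rb : R -> R) :
  stratification rb -> exists m, 0 < m /\ forall y, 0 <= y <= 1 -> m <= rb y.
Proof.
  intros H.
  assert (C : continuity (fun t => rb (clamp t))).
  { apply continuous_on_clamp; intros y hy P [e He].
    destruct (stratification_quotient rb y H hy) as (l & _ & L).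
    destruct (L 1 Rlt_0_1) as [d Hd].
    pose proof (Rabs_pos l) as hl.
    assert (he : 0 < e / (Rabs l + 1))
      by (apply Rdiv_lt_0_compat; [apply cond_pos | lra]).
    assert (hm : 0 < Rmin d (e / (Rabs l + 1)))
      by (apply Rmin_pos; [apply cond_pos | exact he]).
    exists (mkposreal _ hm); intros z hz hz01; apply He.
    change (Rabs (z - y) < Rmin d (e / (Rabs l + 1))) in hz.
    change (Rabs (rb z - rb y) < e).
    pose proof (Rmin_l d (e / (Rabs l + 1))); pose proof (Rmin_r d (e / (Rabs l + 1))).
    destruct (Req_dec z y) as [-> | hzy].
    { rewrite Rminus_diag, Rabs_R0; apply cond_pos. }
    specialize (Hd z ltac:(lra) hzy hz01).
    assert (B : Rabs ((rb z - rb y) / (z - y)) < Rabs l + 1).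
    { replace ((rb z - rb y) / (z - y)) with (((rb z - rb y) / (z - y) - l) + l) by ring.
      eapply Rle_lt_trans; [apply Rabs_triang|]; lra. }
    replace (rb z - rb y) with ((rb z - rb y) / (z - y) * (z - y)) by (field; lra).
    rewrite Rabs_mult.
    assert (hp : 0 < Rabs (z - y)) by (apply Rabs_pos_lt; lra).
    apply Rlt_trans with ((Rabs l + 1) * Rabs (z - y)).
    - now apply Rmult_lt_compat_r.
    - apply (Rmult_lt_reg_l (/ (Rabs l + 1))); [apply Rinv_0_lt_compat; lra|].
      rewrite <- Rmult_assoc, Rinv_l by lra; unfold Rdiv in *; lra. }
  destruct (continuity_ab_min (fun t => rb (clamp t)) 0 1) as (t & Ht & ht); auto.
  { lra. }
  exists (rb (clamp t)); split.
  - apply H, clamp_range.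
  - intros y hy; specialize (Ht y hy); simpl in Ht; rewrite (clamp_id y hy) in Ht.
    exact Ht.
Qed.

Lemma Derive_travelling (c : R) (f : R -> R -> R) (x y : R) :
  ex_derive (fun s => f s y) x ->
  pd_t (travelling c f) 0 x y = - c * partial_derive 1 0 f x y.
Proof.
  intros H; unfold pd_t, travelling.
  rewrite (Derive_comp (fun s => f s y) (fun s => x - c * s)).
  - replace (x - c * 0) with x by ring.
    f_equal; apply is_derive_unique; auto_derive; auto; ring.
  - now replace (x - c * 0) with x by ring.
  - auto_derive; auto.
Qed.

Lemma travelling_mass_equation (g c : R) (rho u v p : R -> R -> R) :
  euler_solution g (travelling c rho) (travelling c u) (travelling c v)
                 (travelling c p) ->
  Cn 1 rho -> forall xi y, channel xi y ->
  (u xi y - c) * partial_derive 1 0 rho xi y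
  + v xi y * partial_derive 0 1 rho xi y = 0.
Proof.
  intros (_ & _ & _ & _ & E & _) Hr xi y hy.
  (* At time 0 the moving coordinate x - c t coincides with x, so this instant yields the equation
     for the profile. *)
  destruct (E 0 xi y hy) as [M _].
  rewrite Derive_travelling in M
    by (eexists; apply (Cn_is_derive_xi 1 0 0 rho); auto).
  unfold pd_x, pd_y, travelling in M.
  replace (xi - c * 0) with xi in M by ring.
  rewrite (Derive_ext _ (fun s => rho s y)) in M.
  - rewrite <- M; change (partial_derive 1 0 rho xi y) with (Derive (fun s => rho s y) xi).
    change (partial_derive 0 1 rho xi y) with (Derive (fun t => rho xi t) y); ring.
  - intros s; now replace (s - c * 0) with s by ring.
Qed.

Lemma stream_Cn (n : nat) (u v psi : R -> R -> R) :
  Cn n u -> Cn n v -> stream u v psi -> Cn (S n) psi.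
Proof.
  intros Hu Hv (_ & H & _); apply (Cn_potential n psi (fun xi y => - v xi y) u);
    auto; now apply Cn_opp.
Qed.

Lemma stream_u (u v psi : R -> R -> R) (xi y : R) :
  stream u v psi -> channel xi y -> u xi y = partial_derive 0 1 psi xi y.
Proof. intros (_ & H & _) hy; symmetry; apply is_derive_unique, H, hy. Qed.

Lemma stream_v (u v psi : R -> R -> R) (xi y : R) :
  stream u v psi -> channel xi y -> v xi y = - partial_derive 1 0 psi xi y.
Proof.
  intros (_ & H & _) hy.
  assert (E : partial_derive 1 0 psi xi y = - v xi y)
    by (apply is_derive_unique, H, hy).
  rewrite E; ring.
Qed.

Lemma stream_pd (u v psi : R -> R -> R) (xi y : R) :
  Cn 2 psi -> stream u v psi -> channel xi y ->
  partial_derive 1 0 u xi y = partial_derive 1 1 psi xi y /\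
  partial_derive 0 1 u xi y = partial_derive 0 2 psi xi y /\
  partial_derive 1 0 v xi y = - partial_derive 2 0 psi xi y /\
  partial_derive 0 1 v xi y = - partial_derive 1 1 psi xi y.
Proof.
  intros Hp Hs hy.
  assert (Eu := fun a b h => stream_u u v psi a b Hs h).
  assert (Ev := fun a b h => stream_v u v psi a b Hs h).
  rewrite !(pd_ext _ _ _ _ Eu xi y hy), !(pd_ext _ _ _ _ Ev xi y hy).
  repeat split; try reflexivity.
  - apply is_derive_unique, @is_derive_opp; apply (Cn_is_derive_xi 2 1 0); auto.
  - apply is_derive_unique, @is_derive_opp; apply (Cn_is_derive_y 2 1 0); auto.
Qed.

(** Both the density and its deviation from the stratification are three times differentiable, the
    latter by the decay condition; their difference is the stratification. This gives the continuity
    of [Derive rb] that makes the weight measurable. *)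
Lemma regular_wave_stratification_Cn (g : R) (rb : R -> R) (U : state) :
  regular_wave g rb U -> Cn 3 (fun _ y => rb y).
Proof.
  intros ((Hr & _) & (K1 & K2 & _ & _ & (Hd & _) & _) & _).
  apply (Cn_ext 3 (fun xi y => s_rho U xi y
                     - diff2 (s_rho U) (s_rho (quiescent g rb)) xi y)).
  - intros xi y _; unfold diff2; simpl; ring.
  - now apply Cn_minus.
Qed.

(** * The two systems of equations *)

Lemma CnC_is_derive_0_xi (n : nat) (f : R -> R -> C) (xi y : R) :
  (0 < n)%nat -> CnC n f -> channel xi y ->
  is_deriveC (fun s => f s y) xi (dC 1 0 f xi y).
Proof.
  intros h [H1 H2] hy; split; simpl;
    [apply (Cn_is_derive_xi n 0 0 (re2 f)) | apply (Cn_is_derive_xi n 0 0 (im2 f))];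
    auto; lia.
Qed.

Lemma CnC_is_derive_0_y (n : nat) (f : R -> R -> C) (xi y : R) :
  (0 < n)%nat -> CnC n f -> channel xi y ->
  is_deriveC (fun t => f xi t) y (dC 0 1 f xi y).
Proof.
  intros h [H1 H2] hy; split; simpl;
    [apply (Cn_is_derive_y n 0 0 (re2 f)) | apply (Cn_is_derive_y n 0 0 (im2 f))];
    auto; lia.
Qed.

Lemma exact_iff_closed (P Q : R -> R -> C) :
  CnC 1 P -> CnC 1 Q ->
  (exists p, CnC 2 p /\ forall xi y, channel xi y ->
     dC 1 0 p xi y = P xi y /\ dC 0 1 p xi y = Q xi y) <->
  (forall xi y, channel xi y -> dC 0 1 P xi y = dC 1 0 Q xi y).
Proof.
  intros HP HQ; split.
  - intros (p & Hp & E) xi y hy.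
    rewrite <- (dC_ext 0 1 (dC 1 0 p) P) by (auto; apply E).
    rewrite <- (dC_ext 1 0 (dC 0 1 p) Q) by (auto; apply E).
    (* By definition [dC 1 1] is the xi-derivative of [dC 0 1], so symmetry of second derivatives
       enters only on the other side. *)
    transitivity (dC 1 1 p xi y).
    + apply (is_deriveC_unique (fun t => dC 1 0 p xi t) y).
      * apply (CnC_is_derive_0_y 1); auto; apply (CnC_dC 2); auto.
      * apply (CnC_is_derive_y 2); auto.
    + reflexivity.
  - intros E.
    destruct HP as [HP1 HP2], HQ as [HQ1 HQ2].
    destruct (closed_form_exact (re2 P) (re2 Q) HP1 HQ1) as [p1 H1].
    { intros xi y hy; exact (f_equal Re (E xi y hy)). }
    destruct (closed_form_exact (im2 P) (im2 Q) HP2 HQ2) as [p2 H2].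
    { intros xi y hy; exact (f_equal Im (E xi y hy)). }
    exists (fun xi y => (p1 xi y, p2 xi y)); split.
    + split; [exact (Cn_potential 1 p1 _ _ HP1 HQ1 H1)
             |exact (Cn_potential 1 p2 _ _ HP2 HQ2 H2)].
    + intros xi y hy; destruct (H1 xi y hy) as [a1 b1], (H2 xi y hy) as [a2 b2].
      split; [rewrite (surjective_pairing (P xi y))
             |rewrite (surjective_pairing (Q xi y))];
        apply injective_projections; simpl;
        apply is_derive_unique; assumption.
Qed.

Lemma dyC_continuous (n k a b : nat) (f : R -> R -> C) (xi y : R) :
  (a + b + k <= n)%nat -> CnC n f -> channel xi y ->
  continuousC (dyC k (dC a b f xi)) y.
Proof.
  intros h Hf hy.
  destruct (dC_continuous n a (b + k) f xi y) as [C1 C2]; auto; [lia|].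
  assert (E : locally y (fun t => dC a (b + k) f xi t = dyC k (dC a b f xi) t)).
  { apply interval_locally; auto; intros t ht; symmetry; apply (dyC_dC n); auto. }
  split; eapply continuity_pt_ext_loc; [|exact C1| |exact C2];
    revert E; apply filter_imp; intros t ->; reflexivity.
Qed.

Lemma pd_continuous_y (n a b : nat) (f : R -> R -> R) (xi y : R) :
  (a + b <= n)%nat -> Cn n f -> channel xi y ->
  continuity_pt (fun t => partial_derive a b f xi t) y.
Proof.
  intros h Hf hy; apply continuity_pt_filterlim.
  apply (continuity_2d_pt_section_y (partial_derive a b f)).
  now apply (Cn_pd_continuous n).
Qed.

(** * Curl of the momentum equations and the rows of the operator *)

Section Coefficients.

Variables (g c : R) (kappa : C) (rc q : R -> R -> R) (rho psi : R -> R -> C).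
Hypothesis rc_smooth : Cn 3 rc.
Hypothesis q_smooth : Cn 4 q.
Hypothesis rho_smooth : CnC 1 rho.
Hypothesis psi_smooth : CnC 3 psi.
Hypothesis q_y_neq : forall xi y, channel xi y -> partial_derive 0 1 q xi y - c <> 0.
Hypothesis rc_neq : forall xi y, channel xi y -> rc xi y <> 0.

Open Scope C_scope.

(* [force_x] and [force_y] are minus the gradient of the perturbation pressure
   in the linearised momentum equations. *)
Definition force_x (xi y : R) : C :=
  rc xi y * kappa * dC 0 1 psi xi y
  + rc xi y * ((pd 0 1 q xi y - c) * dC 1 1 psi xi y
               + dC 0 1 psi xi y * pd 1 1 q xi y
               - pd 1 0 q xi y * dC 0 2 psi xi y
               - dC 1 0 psi xi y * pd 0 2 q xi y)
  + rho xi y * ((pd 0 1 q xi y - c) * pd 1 1 q xi y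
                - pd 1 0 q xi y * pd 0 2 q xi y).

Definition force_y (xi y : R) : C :=
  - rc xi y * kappa * dC 1 0 psi xi y
  + rc xi y * (- (pd 0 1 q xi y - c) * dC 2 0 psi xi y
               - dC 0 1 psi xi y * pd 2 0 q xi y
               + pd 1 0 q xi y * dC 1 1 psi xi y
               + dC 1 0 psi xi y * pd 1 1 q xi y)
  + rho xi y * (- (pd 0 1 q xi y - c) * pd 2 0 q xi y
                + pd 1 0 q xi y * pd 1 1 q xi y)
  + g * rho xi y.

Ltac smoothC :=
  lazymatch goal with
  | |- CnC _ (fun _ _ => ?k) => apply CnC_const
  | |- CnC _ (fun _ _ => Cplus _ _) => apply CnC_plus; smoothC
  | |- CnC _ (fun _ _ => Cminus _ _) => apply CnC_minus; smoothC
  | |- CnC _ (fun _ _ => Copp _) => apply CnC_opp; smoothC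
  | |- CnC _ (fun _ _ => Cmult _ _) => apply CnC_mult; smoothC
  | |- CnC _ (fun _ _ => RtoC (partial_derive ?a ?b q _ _)) =>
      apply (CnC_RtoC _ (partial_derive a b q)), (Cn_le _ (4 - (a + b)));
        [simpl; lia | apply Cn_pd; [lia | assumption]]
  | |- CnC _ (fun _ _ => RtoC (rc _ _)) =>
      apply (CnC_RtoC _ rc), (Cn_le _ 3); [lia | assumption]
  | |- CnC _ (dC ?a ?b psi) =>
      apply (CnC_dC 3); [lia | assumption]
  | |- CnC _ rho => assumption
  end.

(** The forces contain second derivatives of psi and rho itself, so [CnC 3] and [CnC 1] leave one
    derivative: enough for the curl and for a C^2 pressure. *)
Lemma force_x_smooth : CnC 1 force_x.
Proof. unfold force_x; smoothC. Qed.

Lemma force_y_smooth : CnC 1 force_y.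
Proof. unfold force_y; smoothC. Qed.

Ltac derive_y :=
  lazymatch goal with
  | |- is_deriveC (fun _ => ?k) _ _ => apply is_deriveC_const
  | |- is_deriveC (fun _ => Cplus _ _) _ _ => apply is_deriveC_plus; derive_y
  | |- is_deriveC (fun _ => Cminus _ _) _ _ => apply is_deriveC_minus; derive_y
  | |- is_deriveC (fun _ => Copp _) _ _ => apply is_deriveC_opp; derive_y
  | |- is_deriveC (fun _ => Cmult _ _) _ _ => apply is_deriveC_mult; derive_y
  | |- is_deriveC (fun _ => RtoC (partial_derive ?a ?b q _ _)) _ _ =>
      apply is_deriveC_RtoC, (Cn_is_derive_y 4 a b q); [lia | assumption | assumption]
  | |- is_deriveC (fun _ => RtoC (rc _ _)) _ _ =>
      apply is_deriveC_RtoC, (Cn_is_derive_y 3 0 0 rc); [lia | assumption | assumption]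
  | |- is_deriveC (dC ?a ?b psi _) _ _ =>
      apply (CnC_is_derive_y 3); [lia | assumption | assumption]
  | |- is_deriveC (rho _) _ _ =>
      apply (CnC_is_derive_0_y 1); [lia | assumption | assumption]
  end.

Ltac derive_xi :=
  lazymatch goal with
  | |- is_deriveC (fun _ => ?k) _ _ => apply is_deriveC_const
  | |- is_deriveC (fun _ => Cplus _ _) _ _ => apply is_deriveC_plus; derive_xi
  | |- is_deriveC (fun _ => Cminus _ _) _ _ => apply is_deriveC_minus; derive_xi
  | |- is_deriveC (fun _ => Copp _) _ _ => apply is_deriveC_opp; derive_xi
  | |- is_deriveC (fun _ => Cmult _ _) _ _ => apply is_deriveC_mult; derive_xi
  | |- is_deriveC (fun _ => RtoC (partial_derive ?a ?b q _ _)) _ _ =>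
      apply is_deriveC_RtoC, (Cn_is_derive_xi 4 a b q); [lia | assumption | assumption]
  | |- is_deriveC (fun _ => RtoC (rc _ _)) _ _ =>
      apply is_deriveC_RtoC, (Cn_is_derive_xi 3 0 0 rc); [lia | assumption | assumption]
  | |- is_deriveC (fun _ => dC ?a ?b psi _ _) _ _ =>
      apply (CnC_is_derive_xi 3); [lia | assumption | assumption]
  | |- is_deriveC (fun _ => rho _ _) _ _ =>
      apply (CnC_is_derive_0_xi 1); [lia | assumption | assumption]
  end.

Lemma row_1 (xi y : R) : channel xi y ->
  w1 (Aop g c rc q kappa xi (Wof rho psi xi)) y =
  (- kappa * rho xi y + pd 1 0 q xi y * dC 0 1 rho xi y
   - pd 1 0 rc xi y * dC 0 1 psi xi y + pd 0 1 rc xi y * dC 1 0 psi xi y)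
  / (pd 0 1 q xi y - c).
Proof.
  intros hy; simpl; unfold tR1, tR2, tR3.
  change (dyC 1 (rho xi) y) with (dC 0 1 rho xi y).
  change (dyC 1 (psi xi) y) with (dC 0 1 psi xi y).
  unfold Cdiv; ring.
Qed.

(* Eliminating rho_xi by the first row turns the curl of the momentum
   equations into the fourth row, with leading coefficient
   (psi^c_y - c) rho^c. *)
Lemma curl_force (xi y : R) : channel xi y ->
  dC 1 0 rho xi y = w1 (Aop g c rc q kappa xi (Wof rho psi xi)) y ->
  dC 0 1 force_x xi y - dC 1 0 force_y xi y =
  (pd 0 1 q xi y - c) * rc xi y
  * (dC 3 0 psi xi y - w4 (Aop g c rc q kappa xi (Wof rho psi xi)) y).
Proof.
  intros hy E; rewrite (row_1 xi y hy) in E.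
  (* The derivative is left open and filled in by the product rules as [derive_y] descends through
     the expression. *)
  eassert (Hx : is_deriveC (fun t => force_x xi t) y _)
    by (unfold force_x; derive_y).
  eassert (Hy : is_deriveC (fun s => force_y s y) xi _)
    by (unfold force_y; derive_xi).
  rewrite (is_deriveC_unique _ _ _ _
    (CnC_is_derive_0_y 1 _ xi y Nat.lt_0_1 force_x_smooth hy) Hx).
  rewrite (is_deriveC_unique _ _ _ _
    (CnC_is_derive_0_xi 1 _ xi y Nat.lt_0_1 force_y_smooth hy) Hy).
  clear Hx Hy; simpl; unfold tS1, tS2, tS3, tS4.
  change (dyC 1 (rho xi) y) with (dC 0 1 rho xi y).
  change (dyC 1 (psi xi) y) with (dC 0 1 psi xi y).
  change (dyC 2 (psi xi) y) with (dC 0 2 psi xi y).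
  change (dyC 3 (psi xi) y) with (dC 0 3 psi xi y).
  rewrite (dyC_dC 3 1 1 0), (dyC_dC 3 2 1 0), (dyC_dC 3 1 2 0) by (auto; lia).
  (* The derivative rho_xi, produced by [force_y], is replaced by the first row. What remains is a
     rational identity between values at one point, with denominators u^c - c and rho^c. *)
  simpl; rewrite E.
  assert (h1 : RtoC (pd 0 1 q xi y) - RtoC c <> 0).
  { rewrite <- RtoC_minus; intros h; apply (q_y_neq xi y hy); now apply RtoC_inj. }
  assert (h2 : RtoC (rc xi y) <> 0).
  { intros h; apply (rc_neq xi y hy); now apply RtoC_inj. }
  change (pd 0 0 rc xi y) with (rc xi y).
  field; split; assumption.
Qed.

Ltac continuous_y :=
  lazymatch goal with
  | |- continuousC (fun _ => ?k) _ => apply continuousC_const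
  | |- continuousC (fun _ => Cplus _ _) _ => apply continuousC_plus; continuous_y
  | |- continuousC (fun _ => Cminus _ _) _ => apply continuousC_minus; continuous_y
  | |- continuousC (fun _ => Copp _) _ => apply continuousC_opp; continuous_y
  | |- continuousC (fun _ => Cmult _ _) _ => apply continuousC_mult; continuous_y
  | |- continuousC (fun _ => Cinv _) _ =>
      apply continuousC_inv; [try assumption | continuous_y]
  | |- continuousC (fun _ => RtoC (partial_derive ?a ?b q _ _)) _ =>
      apply continuousC_RtoC, (pd_continuous_y 4); [lia | assumption | assumption]
  | |- continuousC (fun _ => RtoC (partial_derive ?a ?b rc _ _)) _ =>
      apply continuousC_RtoC, (pd_continuous_y 3); [lia | assumption | assumption]
  | |- continuousC (fun _ => RtoC (rc _ _)) _ =>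
      apply continuousC_RtoC, (pd_continuous_y 3 0 0 rc); [lia | assumption | assumption]
  | |- continuousC (dyC ?k (dC ?a ?b psi _)) _ =>
      apply (dyC_continuous 3); [lia | assumption | assumption]
  | |- continuousC (dyC ?k (psi _)) _ =>
      apply (dC_continuous 3 0 k psi); [lia | assumption | assumption]
  | |- continuousC (dyC ?k (rho _)) _ =>
      apply (dC_continuous 1 0 k rho); [lia | assumption | assumption]
  | |- continuousC (dC ?a ?b psi _) _ =>
      apply (dC_continuous 3); [lia | assumption | assumption]
  | |- continuousC (rho _) _ =>
      apply (dC_continuous 1 0 0 rho); [lia | assumption | assumption]
  end.

(** The highest y-derivatives that occur, three for psi and one for rho, are still continuous; this
    upgrades the rows from almost every y to every y. *)
Lemma Aop_continuous (xi y : R) : channel xi y ->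
  continuousC (w1 (Aop g c rc q kappa xi (Wof rho psi xi))) y /\
  continuousC (w4 (Aop g c rc q kappa xi (Wof rho psi xi))) y.
Proof.
  intros hy.
  assert (h1 : RtoC (pd 0 1 q xi y) - RtoC c <> 0).
  { rewrite <- RtoC_minus; intros h; apply (q_y_neq xi y hy); now apply RtoC_inj. }
  assert (h2 : RtoC (rc xi y) <> 0).
  { intros h; apply (rc_neq xi y hy); now apply RtoC_inj. }
  assert (h3 := Cmult_neq_0 _ _ h1 h2).
  unfold Aop, Wof; cbn [w1 w2 w3 w4].
  unfold tR1, tR2, tR3, tS1, tS2, tS3, tS4, Cdiv.
  split; continuous_y.
Qed.

End Coefficients.

(** * The eigenvalue problem in terms of the stream function *)

Lemma streamC_dC (u v psi : R -> R -> C) (xi y : R) :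
  CnC 2 psi -> streamC u v psi -> channel xi y ->
  u xi y = dC 0 1 psi xi y /\ v xi y = (- dC 1 0 psi xi y)%C /\
  dC 1 0 u xi y = dC 1 1 psi xi y /\ dC 0 1 u xi y = dC 0 2 psi xi y /\
  dC 1 0 v xi y = (- dC 2 0 psi xi y)%C /\ dC 0 1 v xi y = (- dC 1 1 psi xi y)%C.
Proof.
  intros [Hp1 Hp2] [H1 H2] hy.
  assert (e1 := stream_u _ _ _ xi y H1 hy); assert (e2 := stream_u _ _ _ xi y H2 hy).
  assert (f1 := stream_v _ _ _ xi y H1 hy); assert (f2 := stream_v _ _ _ xi y H2 hy).
  destruct (stream_pd _ _ _ xi y Hp1 H1 hy) as (a1 & a2 & a3 & a4).
  destruct (stream_pd _ _ _ xi y Hp2 H2 hy) as (b1 & b2 & b3 & b4).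
  repeat split; apply injective_projections; assumption.
Qed.

(** Reduces the passage between two forms of a linear equation, up to sign and order of terms, to a
    single ring identity. *)
Lemma Ceq_of_sub (a b l r : C) : l = r -> (a - b = r - l)%C -> a = b.
Proof.
  intros -> E; replace a with (b + (a - b))%C by ring; rewrite E; ring.
Qed.

Lemma eq_Cdiv (a b d : C) : d <> 0 -> a = (b / d)%C <-> (a * d)%C = b.
Proof. intros hd; split; [intros -> | intros <-]; field; exact hd. Qed.

Lemma dC_opp_xi (f : R -> R -> C) (xi y : R) :
  dC 1 0 (fun xi y => - f xi y)%C xi y = (- dC 1 0 f xi y)%C.
Proof. apply injective_projections; apply Derive_opp. Qed.

Lemma dC_opp_y (f : R -> R -> C) (xi y : R) :
  dC 0 1 (fun xi y => - f xi y)%C xi y = (- dC 0 1 f xi y)%C.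
Proof. apply injective_projections; apply Derive_opp. Qed.

(** The system is linear in rho_xi, p_xi and p_y, each occurring in one equation, and can be solved
    for them; u^c - c is the only divisor. The pressure then enters through its gradient alone. *)
Lemma euler_eigenproblem_stream (g c : R) (U : state) (kappa : C)
    (psic : R -> R -> R) (rho u v p psi : R -> R -> C) :
  Cn 2 psic -> stream (s_u U) (s_v U) psic -> CnC 2 psi -> streamC u v psi ->
  (forall xi y, channel xi y -> partial_derive 0 1 psic xi y - c <> 0) ->
  euler_eigenproblem g c U kappa rho u v p <->
  (forall xi y, channel xi y ->
     dC 1 0 rho xi y =
       w1 (Aop g c (s_rho U) psic kappa xi (Wof rho psi xi)) y /\
     dC 1 0 p xi y = (- force_x c kappa (s_rho U) psic rho psi xi y)%C /\
     dC 0 1 p xi y = (- force_y g c kappa (s_rho U) psic rho psi xi y)%C).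
Proof.
  intros Hq Sq Hpsi Spsi hden; unfold euler_eigenproblem.
  split; intros H xi y hy; specialize (H xi y hy); revert H; cbv zeta;
    rewrite row_1 by exact hy; unfold force_x, force_y;
    destruct (stream_pd _ _ _ xi y Hq Sq hy) as (-> & -> & -> & ->);
    rewrite (stream_u _ _ _ xi y Sq hy), (stream_v _ _ _ xi y Sq hy);
    destruct (streamC_dC _ _ _ xi y Hpsi Spsi hy) as (-> & -> & -> & -> & -> & ->);
    rewrite !RtoC_opp;
    assert (h : (RtoC (partial_derive 0 1 psic xi y) - RtoC c)%C <> 0)
      by (rewrite <- RtoC_minus; intros h; apply (hden xi y hy); now apply RtoC_inj);
    set (d := (RtoC (partial_derive 0 1 psic xi y) - RtoC c)%C) in *.
  - intros (E1 & E2 & E3 & _); split; [|split].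
    + rewrite eq_Cdiv by exact h; apply (Ceq_of_sub _ _ _ _ E1); unfold d; ring.
    + apply (Ceq_of_sub _ _ _ _ E2); unfold d; ring.
    + apply (Ceq_of_sub _ _ _ _ E3); unfold d; ring.
  - intros (E1 & E2 & E3); rewrite eq_Cdiv in E1 by exact h.
    split; [|split; [|split]].
    + apply (Ceq_of_sub _ _ _ _ E1); unfold d; ring.
    + apply (Ceq_of_sub _ _ _ _ E2); unfold d; ring.
    + apply (Ceq_of_sub _ _ _ _ E3); unfold d; ring.
    + ring.
Qed.

(** * Equivalence of the eigenvalue problem and the equation in W *)

Theorem theorem1
    (g : R) (hg : (0 < g)%R)
    (rb : R -> R) (hrb : stratification rb)
    (c : R) (U : state)
    (hU : solitary_wave g rb c U) (hreg : regular_wave g rb U)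
    (psic : R -> R -> R) (hpsic : stream (s_u U) (s_v U) psic)
    (hden : forall xi y : R, channel xi y -> (partial_derive 0 1 psic xi y - c <> 0)%R)
    (kappa : C)
    (rho u v psi : R -> R -> C)
    (hrho : CnC 1 rho) (hu : CnC 2 u) (hv : CnC 2 v) (hpsi : CnC 3 psi)
    (hstream : streamC u v psi)
    (hW : Wdifferentiable rb (Wof rho psi)) :
  (exists p : R -> R -> C,
     CnC 2 p /\ euler_eigenproblem g c U kappa rho u v p)
  <->
  solves_ODE rb (Aop g c (s_rho U) psic kappa) (Wof rho psi).
Proof.
  destruct (proj1 hreg) as (Crho & Cu & Cv & _).
  assert (Hq : Cn 4 psic) by exact (stream_Cn 3 _ _ _ Cu Cv hpsic).
  assert (Hrb : Cn 3 (fun _ y => rb y))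
    by exact (regular_wave_stratification_Cn g rb U hreg).
  assert (rb_neg : forall y, 0 < y < 1 -> Derive rb y < 0)
    by (intros; now apply stratification_Derive_neg).
  assert (rb_cont : forall y, 0 < y < 1 -> continuity_pt (Derive rb) y).
  { intros y hy; apply (pd_continuous_y 3 0 1 (fun _ y => rb y) 0 y); auto. }
  destruct hU as (HE & Hlim & _).
  assert (rc_pos : forall xi y, channel xi y -> 0 < s_rho U xi y).
  { destruct (stratification_lower_bound rb hrb) as (m & hm & Hm).
    apply (transported_density_pos (s_rho U) psic rb c m); auto;
      [apply (Cn_le 1 3) | apply (Cn_le 1 4) | apply hpsic | apply hpsic |]; auto.
    - intros xi y hy.
      rewrite <- (travelling_mass_equation g c _ _ _ _ HE (Cn_le 1 3 _ ltac:(auto) Crho)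
                    xi y hy).
      rewrite (stream_u _ _ _ xi y hpsic hy), (stream_v _ _ _ xi y hpsic hy); ring. }
  assert (rc_neq : forall xi y, channel xi y -> s_rho U xi y <> 0)
    by (intros xi y hy E; specialize (rc_pos xi y hy); lra).
  set (A := Aop g c (s_rho U) psic kappa).
  set (W := Wof rho psi).
  (* The pointwise derivative of W. Its second and third components coincide with those of
     [A xi (W xi)] by definition. *)
  set (V := fun xi => mkW (dC 1 0 rho xi) (dC 1 0 psi xi) (dC 2 0 psi xi)
                          (dC 3 0 psi xi)).
  assert (Wm : forall xi, measW (W xi)) by (intros xi; apply inW_measW, hW).
  assert (Wd : forall xi y, 0 < y < 1 ->
    is_deriveC (fun s => w1 (W s) y) xi (w1 (V xi) y) /\
    is_deriveC (fun s => w2 (W s) y) xi (w2 (V xi) y) /\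
    is_deriveC (fun s => w3 (W s) y) xi (w3 (V xi) y) /\
    is_deriveC (fun s => w4 (W s) y) xi (w4 (V xi) y)).
  { intros xi y hy; simpl; split; [|split; [|split]].
    - apply (CnC_is_derive_0_xi 1); [lia | exact hrho | exact hy].
    - apply (CnC_is_derive_0_xi 3); [lia | exact hpsi | exact hy].
    - apply (CnC_is_derive_xi 3); [lia | exact hpsi | exact hy].
    - apply (CnC_is_derive_xi 3); [lia | exact hpsi | exact hy]. }
  (* The pressure is eliminated here, leaving pointwise identities that involve neither the norm of
     W nor integrals. *)
  assert (rows : (exists p, CnC 2 p /\ euler_eigenproblem g c U kappa rho u v p) <->
    (forall xi y, channel xi y ->
       w1 (V xi) y = w1 (A xi (W xi)) y /\ w4 (V xi) y = w4 (A xi (W xi)) y)).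
  { set (P := force_x c kappa (s_rho U) psic rho psi).
    set (Q := force_y g c kappa (s_rho U) psic rho psi).
    assert (HP : CnC 1 P) by (apply force_x_smooth; auto).
    assert (HQ : CnC 1 Q) by (apply force_y_smooth; auto).
    assert (iff1 := fun p => euler_eigenproblem_stream g c U kappa psic rho u v p psi).
    (* The curl identity presupposes the first row, so this equivalence is conditional on it; each
       direction below establishes [R1] before using it. *)
    assert (Hd : (forall xi y, channel xi y -> w1 (V xi) y = w1 (A xi (W xi)) y) ->
      (forall xi y, channel xi y -> dC 0 1 P xi y = dC 1 0 Q xi y) <->
      (forall xi y, channel xi y -> w4 (V xi) y = w4 (A xi (W xi)) y)).
    { intros H1.
      assert (K := fun xi y hy => curl_force g c kappa (s_rho U) psic rho psi
                     Crho Hq hrho hpsi hden rc_neq xi y hy (H1 xi y hy)).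
      split; intros H xi y hy; specialize (K xi y hy); specialize (H xi y hy).
      - fold P Q in K; rewrite H in K.
        assert (h1 : (RtoC (partial_derive 0 1 psic xi y) - RtoC c)%C <> 0).
        { rewrite <- RtoC_minus; intros h; apply (hden xi y hy); now apply RtoC_inj. }
        assert (h2 : RtoC (s_rho U xi y) <> 0).
        { intros h; apply (rc_neq xi y hy); now apply RtoC_inj. }
        destruct (Ceq_dec (w4 (V xi) y) (w4 (A xi (W xi)) y)) as [e | n]; [exact e|].
        exfalso; apply (Cmult_neq_0 _ _ (Cmult_neq_0 _ _ h1 h2) (Cminus_eq_contra _ _ n)).
        change (w4 (V xi) y) with (dC 3 0 psi xi y).
        unfold A, W; rewrite <- K; ring.
      - fold P Q in K; apply Ceq_minus; rewrite K.
        change (dC 3 0 psi xi y) with (w4 (V xi) y).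
        fold A W; rewrite H by exact hy; ring. }
    (* The signs are reversed because the pressure gradient is minus the force; [iff3] removes them
       from the curl condition. *)
    assert (iff2 := exact_iff_closed (fun xi y => - P xi y)%C (fun xi y => - Q xi y)%C
                      (CnC_opp _ _ HP) (CnC_opp _ _ HQ)).
    assert (iff3 : (forall xi y, channel xi y ->
        dC 0 1 (fun xi y => - P xi y)%C xi y = dC 1 0 (fun xi y => - Q xi y)%C xi y) <->
      (forall xi y, channel xi y -> dC 0 1 P xi y = dC 1 0 Q xi y)).
    { split; intros H xi y hy; specialize (H xi y hy).
      - rewrite dC_opp_xi, dC_opp_y in H.
        apply (Ceq_of_sub _ _ _ _ H); ring.
      - rewrite dC_opp_xi, dC_opp_y, H; reflexivity. }
    rewrite iff3 in iff2.
    assert (Hq2 := Cn_le 2 4 _ ltac:(lia) Hq); assert (Hpsi2 := CnC_le 2 3 _ ltac:(lia) hpsi).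
    split.
    - intros (p & Hp & Hep).
      pose proof (proj1 (iff1 p Hq2 hpsic Hpsi2 hstream hden) Hep) as Hrow.
      assert (R1 : forall xi y, channel xi y -> w1 (V xi) y = w1 (A xi (W xi)) y)
        by (intros xi y hy; apply Hrow, hy).
      intros xi y hy; split; [now apply R1|].
      revert xi y hy; apply (proj1 (Hd R1)), (proj1 iff2); exists p; split; [exact Hp|].
      intros xi y hy; apply Hrow, hy.
    - intros H.
      assert (R1 : forall xi y, channel xi y -> w1 (V xi) y = w1 (A xi (W xi)) y)
        by (intros xi y hy; apply H, hy).
      destruct (proj2 iff2) as (p & Hp & Ep).
      { apply (proj2 (Hd R1)); intros xi y hy; apply H, hy. }
      exists p; split; [exact Hp|].
      refine (proj2 (iff1 p Hq2 hpsic Hpsi2 hstream hden) _); intros xi y hy.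
      split; [now apply R1 | now apply Ep]. }
  rewrite rows; split.
  (* By the rows, [A xi (W xi)] is itself a pointwise derivative of W, so it can take the place of
     the derivative D supplied by [hW]. *)
  - intros H xi; destruct (proj2 (hW xi)) as [D HD].
    apply (is_Wderive_pointwise rb rb_neg rb_cont W xi _ Wm) with D; auto.
    intros y hy; destruct (H xi y hy) as [E1 E4], (Wd xi y hy) as (D1 & D2 & D3 & D4).
    rewrite <- E1, <- E4; auto.
  - intros H xi y hy.
    apply (is_Wderive_unique rb rb_neg rb_cont W xi (V xi) Wm (Wd xi) _ (H xi)); auto.
    + intros t ht; split.
      * apply (dC_continuous 1 1 0 rho); auto.
      * exact (proj1 (Aop_continuous g c kappa _ _ rho psi Crho Hq hrho hpsi
                          hden rc_neq xi t ht)).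
    + intros t ht; split.
      * apply (dC_continuous 3 3 0 psi); auto.
      * exact (proj2 (Aop_continuous g c kappa _ _ rho psi Crho Hq hrho hpsi
                          hden rc_neq xi t ht)).
Qed.
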